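(* Let $P\subseteq\{3,4,\ldots,\omega\}$, let $W_P$ be the Ważewski dendrite associated with $P$, and let $\mathrm{Homeo}(W_P)$ act on $W_P$ in the natural way. Then the dynamical system $\mathrm{Homeo}(W_P)\curvearrowright W_P$ is not $\mathrm{tame}_1$.
   Context: A dendrite is a compact, connected, locally connected, metrizable topological space $X$ such that for all $x,y\in X$ there is a unique arc in $X$ with endpoints $x$ and $y$. The order of $x\in X$ is the number of connected components of $X\setminus\{x\}$ (written $\omega$ if this number is infinite), and $x$ is a ramification point if its order is at least $3$. A subset of $X$ is arcwise dense if it meets every nondegenerate arc of $X$. For $P\subseteq\{3,4,\ldots,\omega\}$, the Ważewski dendrite $W_P$ is the dendrite characterized up to homeomorphism by the following two properties: for every $p\in P$ the set of ramification points of order $p$ is arcwise dense, and every ramification point has order in $P$. A dynamical system $(X,G)$ is a continuous (faithful) action of a topological group $G$ on a compact space $X$. Its Ellis semigroup $E(X,G)$ is the closure of $G$ (identified with $\{x\mapsto gx : g\in G\}$) in $X^X$ with the topology of pointwise convergence. For a compact metrizable $X$, $\mathrm{Homeo}(X)$ is the group of homeomorphisms of $X$ with the compact-open topology. A function $f:Z\to Y$ between Polish spaces is Baire class 1 if $f^{-1}(U)$ is $F_\sigma$ in $Z$ for every open $U\subseteq Y$. A topological space is a Rosenthal compactum if it is homeomorphic to a compact subspace of $B_1(Z,\mathbb{R})$, the space of Baire class 1 functions $Z\to\mathbb{R}$ with the pointwise convergence topology, for some Polish space $Z$. A dynamical system $(X,G)$ is $\mathrm{tame}_1$ if $E(X,G)$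 is a first countable Rosenthal compactum.
   Formalization: P is assumed nonempty (for P empty, W_P is an arc or a point and the system is tame_1, so the claim fails), and W_P is required to have at least two points, since a one-point space satisfies the two characterizing properties vacuously. *)

(* Defs.v *)
From HB Require Import structures.
From mathcomp Require Import all_boot all_order all_algebra finmap.
From mathcomp Require Import all_classical all_reals all_analysis borel_hierarchy.

Set Implicit Arguments.
Unset Strict Implicit.
Unset Printing Implicit Defensive.

Import Order.TTheory GRing.Theory Num.Theory.
Import numFieldNormedType.Exports.

Local Open Scope classical_set_scope.
Local Open Scope ring_scope.

Definition homeomorphic (X Y : topologicalType) : Prop :=
  exists (f : X -> Y) (g : Y -> X),
    [/\ continuous f, continuous g, cancel f g & cancel g f].

Definition metrizable (R : realType) (X : topologicalType) : Prop :=
  exists M : metricType R, homeomorphic X M.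

Definition separable (X : topologicalType) : Prop :=
  exists2 D : set X, countable D & dense D.

Definition polish (R : realType) (X : topologicalType) : Prop :=
  separable X /\
  exists M : metricType R, homeomorphic X M /\
    forall F : set_system M, ProperFilter F -> cauchy F -> exists x : M, F --> x.

Definition first_countable (X : topologicalType) : Prop :=
  forall x : X, exists2 B : nat -> set X,
    (forall n, nbhs x (B n)) & (forall U, nbhs x U -> exists n, B n `<=` U).

Definition locally_connected (X : topologicalType) : Prop :=
  forall (x : X) (U : set X), nbhs x U ->
    exists V : set X, [/\ open V, V x, connected V & V `<=` U].

(* [A] is the image of a homeomorphism [f : [0, 1] -> A], with inverse [g],
   sending [0] to [x] and [1] to [y]; such an arc is nondegenerate ([x <> y]). *)
Definition arc (R : realType) (X : topologicalType) (x y : X) (A : set X) :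
    Prop :=
  exists (f : R -> X) (g : X -> R),
    [/\ {within `[0, 1], continuous f}, {within A, continuous g},
        f @` `[0, 1] = A, {in `[0, 1], cancel f g} & f 0 = x /\ f 1 = y].

Definition dendrite (R : realType) (X : topologicalType) : Prop :=
  [/\ compact [set: X], connected [set: X], locally_connected X,
      metrizable R X &
      forall x y : X, x <> y -> exists! A : set X, arc R x y A].

Definition arcwise_dense (R : realType) (X : topologicalType) (D : set X) :
    Prop :=
  forall (x y : X) (A : set X), arc R x y A -> D `&` A !=set0.

Definition components (X : topologicalType) (A : set X) : set (set X) :=
  connected_component A @` A.

(* Orders of points live in [option nat], [None] standing for [omega]. *)
Definition point_order (X : topologicalType) (x : X) : option nat :=
  let C := components (~` [set x]) in
  if `[< finite_set C >] then Some #|` fset_set C|%N else None.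

Definition ramification_orders : set (option nat) :=
  [set p | if p is Some n then (3 <= n)%N else True].

Definition ramification_point (X : topologicalType) (x : X) : Prop :=
  ramification_orders (point_order x).

(* For [P] nonempty, the properties below characterize [W_P] up to
   homeomorphism. A one-point space would satisfy the last two vacuously,
   whence the requirement of two distinct points. *)
Definition wazewski_dendrite (R : realType) (P : set (option nat))
    (X : topologicalType) : Prop :=
  [/\ dendrite R X, exists x y : X, x <> y,
      forall p, P p ->
        arcwise_dense R [set x : X | ramification_point x /\ point_order x = p] &
      forall x : X, ramification_point x -> P (point_order x)].

HB.structure Definition PreTopologicalGroup :=
  {G of Topological G & Group G}.

HB.mixin Record PreTopologicalGroup_isTopologicalGroup G
    of PreTopologicalGroup G := {
  mulg_continuous : continuous (fun p : G * G => (p.1 * p.2)%g) ;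
  invg_continuous : continuous (fun g : G => g^-1%g)
}.

#[short(type="topologicalGroupType")]
HB.structure Definition TopologicalGroup :=
  {G of PreTopologicalGroup G & PreTopologicalGroup_isTopologicalGroup G}.

Record dynamical_system := DynamicalSystem {
  ds_space : topologicalType ;
  ds_group : topologicalGroupType ;
  ds_act : ds_group -> ds_space -> ds_space ;
  ds_compact : compact [set: ds_space] ;
  ds_act1 : forall x, ds_act 1%g x = x ;
  ds_actM : forall g h x, ds_act (g * h)%g x = ds_act g (ds_act h x) ;
  ds_act_continuous :
    continuous (fun p : ds_group * ds_space => ds_act p.1 p.2) ;
  ds_faithful : forall g, (forall x, ds_act g x = x) -> g = 1%g
}.

Definition ellis_semigroup (S : dynamical_system) :
    set {ptws ds_space S -> ds_space S} :=
  closure (range (@ds_act S : ds_group S -> {ptws ds_space S -> ds_space S})).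

Arguments ellis_semigroup : clear implicits.

Definition baire_class1 (Z Y : topologicalType) (f : Z -> Y) : Prop :=
  forall U : set Y, open U -> Fsigma (f @^-1` U).

(* [set_type C] carries the subspace topology. *)
Definition rosenthal_compactum (R : realType) (K : topologicalType) : Prop :=
  exists Z : topologicalType, polish R Z /\
  exists C : set {ptws Z -> R},
    [/\ C `<=` [set f | baire_class1 (f : Z -> R)], compact C &
        homeomorphic K (set_type C)].

Definition tame1 (R : realType) (S : dynamical_system) : Prop :=
  first_countable (set_type (ellis_semigroup S)) /\
  rosenthal_compactum R (set_type (ellis_semigroup S)).

Definition homeo_set (X : topologicalType) : set {compact-open, X -> X} :=
  [set f : X -> X | continuous f /\
     exists g : X -> X, [/\ continuous g, cancel f g & cancel g f]].

Arguments homeo_set : clear implicits.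

Definition homeo (X : topologicalType) : Type := set_type (homeo_set X).

HB.instance Definition _ (X : topologicalType) :=
  Topological.on (homeo X).

Definition homeo_fun (X : topologicalType) (f : homeo X) : X -> X := \val f.

Section HomeoGroup.
Variable X : topologicalType.
Implicit Types f g : homeo X.

Lemma homeo_funP f : homeo_set X (homeo_fun f).
Proof. by case: f => f fP; exact: set_mem. Qed.

Lemma homeo_inj f g : homeo_fun f =1 homeo_fun g -> f = g.
Proof. by move=> fg; apply: val_inj; apply/funext. Qed.

Lemma homeo_one_subproof : homeo_set X (id : X -> X).
Proof. by split; [move=> x|exists id; split=> // x]; exact: cvg_id. Qed.

Definition homeo_one : homeo X := SigSub (mem_set homeo_one_subproof).

Lemma homeo_mul_subproof f g : homeo_set X (homeo_fun f \o homeo_fun g).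
Proof.
have [cf [f' [cf' fK f'K]]] := homeo_funP f.
have [cg [g' [cg' gK g'K]]] := homeo_funP g.
split; first by move=> x; apply: continuous_comp; [exact: cg|exact: cf].
exists (g' \o f'); split; [|exact: can_comp|exact: can_comp].
by move=> x; apply: continuous_comp; [exact: cf'|exact: cg'].
Qed.

Definition homeo_mul f g : homeo X := SigSub (mem_set (homeo_mul_subproof f g)).

Lemma homeo_inv_exists f :
  exists g : homeo X, cancel (homeo_fun f) (homeo_fun g)
                   /\ cancel (homeo_fun g) (homeo_fun f).
Proof.
have [cf [f' [cf' fK f'K]]] := homeo_funP f.
have f'P : homeo_set X f' by split=> //; exists (homeo_fun f).
by exists (SigSub (mem_set f'P)).
Qed.

Definition homeo_inv f : homeo X := projT1 (cid (homeo_inv_exists f)).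

Lemma homeo_invK f : cancel (homeo_fun f) (homeo_fun (homeo_inv f)).
Proof. by rewrite /homeo_inv; case: cid => g []. Qed.

Lemma homeo_invVK f : cancel (homeo_fun (homeo_inv f)) (homeo_fun f).
Proof. by rewrite /homeo_inv; case: cid => g []. Qed.

Lemma homeo_mulA : associative homeo_mul.
Proof. by move=> f g h; exact: homeo_inj. Qed.

Lemma homeo_mul1 : left_id homeo_one homeo_mul.
Proof. by move=> f; exact: homeo_inj. Qed.

Lemma homeo_mulr1 : right_id homeo_one homeo_mul.
Proof. by move=> f; exact: homeo_inj. Qed.

Lemma homeo_mulV : left_inverse homeo_one homeo_inv homeo_mul.
Proof. by move=> f; apply: homeo_inj => x; exact: homeo_invK. Qed.

Lemma homeo_mulrV : right_inverse homeo_one homeo_inv homeo_mul.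
Proof. by move=> f; apply: homeo_inj => x; exact: homeo_invVK. Qed.

HB.instance Definition _ := isGroup.Build (homeo X)
  homeo_mulA homeo_mul1 homeo_mulr1 homeo_mulV homeo_mulrV.

Lemma homeo_continuous f : continuous (homeo_fun f).
Proof. by have [] := homeo_funP f. Qed.

Lemma homeo_cvgP (F : set_system (homeo X)) f : Filter F ->
  (forall K O : set X, compact K -> open O -> homeo_fun f @` K `<=` O ->
     F [set g | homeo_fun g @` K `<=` O]) -> F --> f.
Proof.
move=> FF FKO U [_ [[/= V oV <-] Vf VU]].
have cF : (set_val : homeo X -> {compact-open, X -> X}) @ F -->
    (set_val f : {compact-open, X -> X}).
  by apply/compact_open_cvgP => K O cK oO fKO; exact: FKO.
by apply: (filterS VU); apply: cF; exact: open_nbhs_nbhs.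
Qed.

Lemma homeo_nbhs f (K O : set X) : compact K -> open O ->
  homeo_fun f @` K `<=` O -> nbhs f [set g | homeo_fun g @` K `<=` O].
Proof.
move=> cK oO fKO.
have cv : continuous (set_val : homeo X -> {compact-open, X -> X}).
  exact: (@initial_continuous (homeo X) {compact-open, X -> X} set_val).
apply: (cv f [set g : {compact-open, X -> X} | g @` K `<=` O]).
by apply: open_nbhs_nbhs; split=> //; exact: compact_open_open.
Qed.

End HomeoGroup.

Section HomeoSystem.
Variables (X : topologicalType).
Hypotheses (cX : compact [set: X]) (hX : hausdorff_space X).

Lemma homeo_act_continuous :
  continuous (fun p : homeo X * X => homeo_fun p.1 p.2).
Proof.
move=> [f x] U /= Ufx.
have /(homeo_continuous (x := x)) : nbhs (homeo_fun f x) U° by exact: nbhs_interior.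
move/(compact_regular hX cX (filterT : nbhs x setT)) => [C Cx CU].
exists ([set g | homeo_fun g @` closure C `<=` U°], C).
  split=> //=; apply: homeo_nbhs.
  - exact: subclosed_compact (@closed_closure _ _) cX _.
  - exact: open_interior.
  - by move=> _ [y /CU + <-].
move=> [g y] [/= gC Cy]; apply: interior_subset; apply: gC; exists y => //.
exact: subset_closure.
Qed.

Lemma homeo_mul_continuous :
  continuous (fun p : homeo X * homeo X => (p.1 * p.2)%g).
Proof.
move=> [f g]; apply: homeo_cvgP => K O cK oO /= fgKO.
have cgK : compact (homeo_fun g @` K).
  by apply: continuous_compact => //; apply: continuous_subspaceT; exact: homeo_continuous.
have ofO : open (homeo_fun f @^-1` O).
  by apply: open_comp => // x _; exact: homeo_continuous.
have gKO : homeo_fun g @` K `<=` homeo_fun f @^-1` O.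
  by move=> _ [x Kx <-]; apply: fgKO; exists x.
have /(compact_normal hX cX (compact_closed hX cgK)) [C nC CO] :
    set_nbhs (homeo_fun g @` K) (homeo_fun f @^-1` O).
  by move=> x /gKO fx; exact: open_nbhs_nbhs.
have KC : homeo_fun g @` K `<=` C° by move=> x /nC.
exists ([set h | homeo_fun h @` closure C `<=` O],
        [set h | homeo_fun h @` K `<=` C°]).
  split=> /=; apply: homeo_nbhs => //.
  - exact: subclosed_compact (@closed_closure _ _) cX _.
  - by move=> _ [x /CO + <-].
  - exact: open_interior.
move=> [h k] [/= hC kK] _ [x Kx <-].
apply: (hC (homeo_fun h (homeo_fun k x))); apply: imageP.
by apply: subset_closure; apply: interior_subset; apply: kK; exact: imageP.
Qed.

Lemma homeo_inv_continuous : continuous (fun f : homeo X => f^-1%g).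
Proof.
move=> f; have FF := nbhs_filter f.
apply: (@homeo_cvgP X _ (f^-1)%g) => K O cK oO fKO.
have sub (g : homeo X) : homeo_fun g^-1%g @` K `<=` O <->
    homeo_fun g @` (~` O) `<=` ~` K.
  split=> gKO _ [x xP <-].
  - move=> Kgx; apply: xP.
    by rewrite -[x](homeo_invK g); apply: gKO; exact: imageP.
  - apply: contrapT => /(imageP (homeo_fun g)) /gKO.
    by rewrite (homeo_invVK g); apply.
suff : nbhs f [set g | homeo_fun g @` (~` O) `<=` ~` K].
  by apply: filterS => g /sub.
apply: homeo_nbhs; last exact/sub.
  by apply: subclosed_compact cX _ => //; exact: open_closedC.
by apply: closed_openC; exact: compact_closed.
Qed.

End HomeoSystem.

Lemma metrizable_hausdorff (R : realType) (X : topologicalType) :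
  metrizable R X -> hausdorff_space X.
Proof.
move=> [M [f [g [cf cg fK gK]]]] x y xy; apply: (can_inj fK).
apply: (@metric_hausdorff R M) => A B /cf fA /cf fB.
by have [z [Az Bz]] := xy _ _ fA fB; exists (f z).
Qed.

Section HomeoSystemMetrizable.
Variables (R : realType) (X : topologicalType).
Hypotheses (cX : compact [set: X]) (mX : metrizable R X).

Let hX := metrizable_hausdorff mX.

Definition homeo_group : topologicalGroupType :=
  HB.pack_for topologicalGroupType (homeo X)
    (PreTopologicalGroup_isTopologicalGroup.Build (homeo X)
       (homeo_mul_continuous cX hX) (homeo_inv_continuous cX hX)).

Lemma homeo_act1 (x : X) : homeo_fun (1%g : homeo_group) x = x.
Proof. by []. Qed.

Lemma homeo_actM (g h : homeo_group) (x : X) :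
  homeo_fun (g * h)%g x = homeo_fun g (homeo_fun h x).
Proof. by []. Qed.

Lemma homeo_faithful (g : homeo_group) :
  (forall x, homeo_fun g x = x) -> g = 1%g.
Proof. by move=> g1; apply: homeo_inj. Qed.

Definition homeo_system : dynamical_system :=
  @DynamicalSystem X homeo_group (@homeo_fun X) cX homeo_act1 homeo_actM
    (homeo_act_continuous cX hX) homeo_faithful.

End HomeoSystemMetrizable.

Lemma wazewski_compact (R : realType) (P : set (option nat))
    (W : topologicalType) :
  wazewski_dendrite R P W -> compact [set: W].
Proof. by case=> -[]. Qed.

Lemma wazewski_metrizable (R : realType) (P : set (option nat))
    (W : topologicalType) :
  wazewski_dendrite R P W -> metrizable R W.
Proof. by case=> -[]. Qed.

(* Main.v *)
(* Let e be an endpoint of W. For every endpoint x <> e, the map f_x sending x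
   to x and everything else to e is a pointwise limit of homeomorphisms, and so
   is the constant map e. In the topology of pointwise convergence, a
   neighbourhood of the constant map contains all but finitely many of the f_x.
   There are uncountably many endpoints, so no countable family of
   neighbourhoods of the constant map shrinks to it: the Ellis semigroup is not
   first countable.

   To approximate f_x, take ramification points r close to x and t close to e,
   of the same order, and a homeomorphism fixing x and sending r to t. It exists
   by back-and-forth on the ramification points, viewed with the relation
   "a and b lie on the same side of c": finite partial isomorphisms that are
   closed under medians extend one point at a time, and an isomorphism of the
   whole relation extends to W as the closure of its graph.

   All this uses that the interior points of an arc separate its endpoints. If
   c did not separate a from b, the component of W \ {c} containing them would
   contain a second arc from a to b, by the arcwise connectedness of open
   connected subsets of Peano continua: refine chains of small connected sets
   into a path, then erase a maximal open set of loops from the path. *)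
From mathcomp Require Import all_boot all_order all_algebra finmap.
From mathcomp Require Import all_classical all_reals all_analysis.
From mathcomp Require Import lra.
Require Import Defs.

Set Implicit Arguments.
Unset Strict Implicit.
Unset Printing Implicit Defensive.

Import Order.TTheory GRing.Theory Num.Theory.
Import numFieldNormedType.Exports.

Local Open Scope classical_set_scope.
Local Open Scope ring_scope.

(** * Closed graphs and gaps of open subsets of the line *)

(** The points of [K] with second coordinate outside [V°] form a compact set, so their first
    projection is closed; it misses [x] because [g x] is the only value of [K] over [x]. *)
Lemma compact_graph_continuous (X Y : topologicalType) (A : set X)
    (K : set (X * Y)) (g : X -> Y) :
  hausdorff_space X -> compact K ->
  (forall x, A x -> K (x, g x)) ->
  (forall x y, A x -> K (x, y) -> y = g x) -> {within A, continuous g}.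
Proof.
move=> hX cK Kg gK; apply/subspace_continuousP => x Ax V /= nV.
pose C := K `&` (snd @^-1` (~` V°)).
have cC : compact C.
  apply: compact_closedI => //; apply: closed_comp; last first.
    by apply: open_closedC; exact: open_interior.
  by move=> z _; exact: cvg_snd.
have cfC : closed (fst @` C).
  apply: compact_closed => //; apply: continuous_compact => //.
  by apply: continuous_subspaceT => z; exact: cvg_fst.
have Cx : (~` (fst @` C)) x.
  move=> [[x' y] [/= Kxy Vy] xx']; subst x'; apply: Vy.
  by rewrite (gK _ _ Ax Kxy).
have : nbhs x (~` (fst @` C)).
  by apply: open_nbhs_nbhs; split=> //; exact: closed_openC.
apply: filterS => x' Cx' Ax'; apply: contrapT => Vx'.
apply: Cx'; exists (x', g x') => //; split=> //=; first exact: Kg.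
by move=> /interior_subset.
Qed.


Lemma pair_continuous (X Y Z : topologicalType) (f : X -> Y) (g : X -> Z) :
  continuous f -> continuous g -> continuous (fun x => (f x, g x)).
Proof. by move=> cf cg x; apply: cvg_pair; [exact: cf|exact: cg]. Qed.

Section gaps.
Variable R : realType.
Implicit Types (U : set R) (a b s t x y : R).

Lemma open_left_end U a x : open U -> U x -> ~ U a -> a < x ->
  exists2 s, a <= s < x & ~ U s /\ (forall y, s < y -> y <= x -> U y).
Proof.
move=> oO Ox Oa ax.
pose A := [set s | s <= x /\ ~ U s].
have A0 : A !=set0 by exists a; split=> //; exact: ltW.
have Ax : ubound A x by move=> s [].
have hA : has_sup A by split=> //; exists x.
have NO : ~ U (sup A).
  move=> Os; have := open_nbhs_nbhs (conj oO Os);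
    rewrite -nbhs_ballE => -[e /= e0 eO].
  have [s [sx Os'] es] := sup_adherent e0 hA.
  have sA : s <= sup A by apply: (sup_upper_bound hA); split.
  apply: Os'; apply: eO; rewrite /ball /=.
  by rewrite ger0_norm ?subr_ge0// ltrBlDr -ltrBlDl.
exists (sup A).
  rewrite (sup_upper_bound hA) /=; last by split=> //; exact: ltW.
  rewrite lt_neqAle sup_le_ub // andbT; apply/eqP => E.
  by apply: NO; rewrite E.
split=> // y sy yx; apply: contrapT => Oy.
by move: sy; rewrite ltNge (sup_upper_bound hA).
Qed.

Lemma open_right_end U b x : open U -> U x -> ~ U b -> x < b ->
  exists2 t, x < t <= b & ~ U t /\ (forall y, x <= y -> y < t -> U y).
Proof.
move=> oO Ox Ob xb.
have oO' : open (-%R @^-1` U).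
  by apply: open_comp => // z _; exact: opp_continuous.
have [||| s /andP[bs sx] [Os sO]] := @open_left_end _ (- b) (- x) oO'.
- by rewrite /= opprK.
- by rewrite /= opprK.
- by rewrite ltrN2.
exists (- s); first by rewrite ltrNr sx lerNl.
split=> // y xy ys.
by rewrite -(opprK y); apply: sO; [rewrite ltrNr|rewrite lerN2].
Qed.

Lemma open_gap U a b x : open U -> U x -> ~ U a -> ~ U b -> a < x -> x < b ->
  exists s t, [/\ s < x < t, a <= s /\ t <= b, ~ U s, ~ U t &
    forall y, s < y < t -> U y].
Proof.
move=> oO Ox Oa Ob ax xb.
have [s /andP[as' sx] [Os sO]] := open_left_end oO Ox Oa ax.
have [t /andP[xt tb] [Ot tO]] := open_right_end oO Ox Ob xb.
exists s, t; split=> //; first by rewrite sx.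
move=> y /andP[sy yt]; have [yx|xy] := leP y x; first exact: sO.
by apply: tO => //; exact: ltW.
Qed.

Lemma chain_cover (F : set (set R)) (a b : R) :
  a <= b -> total_on F subset -> (forall U, F U -> open U) ->
  (forall y, a <= y <= b -> (\bigcup_(U in F) U) y) ->
  exists2 U, F U & forall y, a <= y <= b -> U y.
Proof.
move=> ab tF oF cF.
have := @segment_compact R a b; rewrite compact_cover => /(_ _ F id).
case=> [U FO|y /=|D DF Dc]; first exact: oF.
  by rewrite in_itv /= => /cF.
have {}Dc : forall y, a <= y <= b -> exists2 U, U \in D & U y.
  by move=> y yab; have [|U OD Oy] := Dc y; [rewrite /= in_itv|exists U].
have [U0 U0D U0a] : exists2 U, U \in D & U a by apply: Dc; rewrite lexx.
have FD U : U \in D -> F U by move=> /DF/set_mem.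
suff [U FO DO] : exists2 U, F U & forall U', U' \in (D : seq _) -> U' `<=` U.
  by exists U => // y /Dc[U' /DO]; apply.
have F0 := FD _ U0D.
have : forall U, U \in (D : seq _) -> F U by [].
elim: (D : seq _) => [_|P s IH sF]; first by exists U0.
have [U FO sO] : exists2 U, F U & forall U', U' \in s -> U' `<=` U.
  by apply: IH => U Os; apply: sF; rewrite inE Os orbT.
have FP : F P by apply: sF; rewrite mem_head.
have [PO|OP] := tF _ _ FP FO.
  by exists U => // U'; rewrite inE => /predU1P[->//|/sO].
exists P => // U'; rewrite inE => /predU1P[->//|/sO].
by move/subset_trans; apply.
Qed.

End gaps.

(** * From paths to arcs *)

Section loop_erasure.
Variables (R : realType) (M : metricType R) (f : R -> M).
Hypothesis f_unif : forall e : R, 0 < e ->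
  exists2 d : R, 0 < d & forall s t, `|s - t| < d -> mdist (f s) (f t) < e.
Implicit Types (U : set R) (s t x y : R).

(* Collapsing the components of [U] to points leaves a path. *)
Definition loops U := [/\ open U, (forall x, U x -> 0 < x < 1) &
  forall s t, s < t -> ~ U s -> ~ U t -> (forall y, s < y < t -> U y) ->
    f s = f t].

(** The chain condition of Zorn's lemma. Compactness puts [[s + e, t - e]] inside one member of the
    chain; the gap of that member around the midpoint has ends near [s] and [t] with equal images,
    so [f s] and [f t] would be closer than their distance. *)
Lemma loops_bigcup (F : set (set R)) :
  F `<=` loops -> total_on F subset -> loops (\bigcup_(U in F) U).
Proof.
move=> Fl tF; split.
- by apply: bigcup_open => U /Fl[].
- by move=> x [U /Fl[_ + _]] => /[apply].
move=> s t st Us Ut stU; apply: contrapT => fst.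
have D0 : 0 < mdist (f s) (f t) by rewrite mdist_gt0; exact/eqP.
have [d d0 fd] := f_unif (divr_gt0 D0 (ltr0n _ 3)).
pose e := Num.min (d / 2) ((t - s) / 4).
have e0 : 0 < e by rewrite lt_min !divr_gt0// subr_gt0.
have [ed et] : e <= d / 2 /\ e <= (t - s) / 4 by rewrite !ge_min !lexx orbT.
have [|||U FU seU] := @chain_cover R F (s + e) (t - e) _ tF.
- lra.
- by move=> U /Fl[].
- by move=> y ye; apply: stU; lra.
have [oU _ fU] := Fl _ FU.
have notU x : ~ (\bigcup_(U in F) U) x -> ~ U x by move=> + Ux; apply; exists U.
have Um : U ((s + t) / 2) by apply: seU; lra.
have [||u [v [uv [su vt] Uu Uv guv]]] :=
  open_gap oU Um (notU _ Us) (notU _ Ut).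
- lra.
- lra.
have ue : u <= s + e.
  by rewrite leNgt; apply/negP => ue; apply: Uu; apply: seU; lra.
have ve : t - e <= v.
  by rewrite leNgt; apply/negP => ve; apply: Uv; apply: seU; lra.
have fuv : f u = f v by apply: fU => //; lra.
have := metric_triangle (f s) (f u) (f t).
have : mdist (f s) (f u) < mdist (f s) (f t) / 3 by apply: fd;
  rewrite ltr_norml; lra.
have : mdist (f v) (f t) < mdist (f s) (f t) / 3 by apply: fd;
  rewrite ltr_norml; lra.
rewrite fuv; lra.
Qed.

(** Zorn's lemma gives a maximal [U]. If [f s = f t] with [s] and [t] outside [U], adjoining []s,
    t[] keeps the property, since a gap of the enlarged set is a gap of [U] or []s, t[] itself. *)
Lemma maximal_loops : exists2 U, loops U &
  forall s t, 0 <= s -> s < t -> t <= 1 -> ~ U s -> ~ U t -> f s = f t ->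
    forall y, s < y < t -> U y.
Proof.
have [U [lU mU]] := Zorn_bigcup loops_bigcup;
  exists U => // s t s0 st t1 Us Ut fst y syt.
apply: contrapT => Uy; pose V := U `|` [set z | s < z < t].
apply: (mU V); first by split; [left|move=> /(_ y) VU; apply: Uy; apply: VU;
  right].
have [oU U01 fU] := lU; split.
- apply: openU => //.
  rewrite (_ : [set _ | _] = [set` `]s, t[]); last first.
    by apply/seteqP; split=> z /=; rewrite in_itv.
  exact: interval_open.
- by move=> x [/U01//|/= ?]; lra.
move=> u v uv Vu Vv guv.
have Uu : ~ U u by move=> ?; apply: Vu; left.
have Uv : ~ U v by move=> ?; apply: Vv; left.
have {}Vu : ~ (s < u < t) by move=> ?; apply: Vu; right.
have {}Vv : ~ (s < v < t) by move=> ?; apply: Vv; right.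
have gap w : ~ U w -> ~ (s < w < t) -> ~ (u < w < v).
  by move=> Uw sw /guv[/Uw|/sw].
have gs := gap _ Us; have gt := gap _ Ut.
have [us|us] := ltP u s; last have [vt|vt] := ltP t v.
- have vs : v <= s.
    by rewrite leNgt; apply/negP => ?; apply: gs; lra.
  apply: fU => // z uzv; have [//|/=] := guv z uzv; lra.
- have tu : t <= u.
    by rewrite leNgt; apply/negP => ?; apply: gt; lra.
  apply: fU => // z uzv; have [//|/=] := guv z uzv; lra.
- have tu : u = s \/ t <= u.
    case: (ltP u t) => ut; [left|by right].
    by apply/eqP; rewrite eq_le us andbT leNgt; apply/negP => ?; apply: Vu; lra.
  case: tu => [->|tu]; last by exfalso; lra.
  suff -> : v = t by [].
  by apply/eqP; rewrite eq_le vt leNgt; apply/negP => ?; apply: Vv; lra.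
Qed.

End loop_erasure.

Section path_to_arc.
Variables (R : realType) (M : metricType R) (f : R -> M).
Hypothesis f_unif : forall e : R, 0 < e ->
  exists2 d : R, 0 < d & forall s t, `|s - t| < d -> mdist (f s) (f t) < e.
Hypothesis f01 : f 0 <> f 1.
Variable U : set R.
Hypothesis lU : loops f U.
Hypothesis mU : forall s t, 0 <= s -> s < t -> t <= 1 -> ~ U s -> ~ U t ->
  f s = f t -> forall y, s < y < t -> U y.
Implicit Types (q s t u v x y : R).

Let oU : open U. Proof. by case: lU. Qed.
Let U01 x : U x -> 0 < x < 1. Proof. by case: lU => _ + _; apply. Qed.
Let fU s t : s < t -> ~ U s -> ~ U t -> (forall y, s < y < t -> U y) ->
  f s = f t.
Proof. by case: lU => _ _; apply. Qed.

Let S : set R := [set t | 0 <= t <= 1 /\ ~ U t].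

Let S0 : S 0. Proof. by split; [lra|move=> /U01; rewrite ltxx]. Qed.
Let S1 : S 1. Proof. by split; [lra|move=> /U01; rewrite ltxx andbF]. Qed.

Let S_gap s s' x : S s -> S s' -> U x -> s < x -> x < s' -> exists u v,
  [/\ u < x < v, s <= u /\ v <= s', S u, S v & f u = f v].
Proof.
move=> [s01 Us] [s'01 Us'] Ux sx xs'.
have [u [v [uxv [su vs'] Uu Uv guv]]] := open_gap oU Ux Us Us' sx xs'.
exists u, v; split=> //; [split=> //; lra..|].
by apply: fU => //; lra.
Qed.

(** The cap at 1 bounds the diameters [h] uniformly, so that their weighted sum converges. *)
Let dm s t : R := Num.min 1 (mdist (f s) (f t)).

Let dm_le1 s t : dm s t <= 1.
Proof. by rewrite ge_min lexx. Qed.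

Let dm_le s t : dm s t <= mdist (f s) (f t).
Proof. by rewrite ge_min lexx orbT. Qed.

Let dm_tri s t u : dm s t <= dm s u + mdist (f u) (f t).
Proof.
have := metric_triangle (f s) (f u) (f t).
have := mdist_ge0 (f u) (f t).
by rewrite /dm /Num.min; case: ifP; case: ifP; lra.
Qed.

Let dmC s t : dm s t = dm t s.
Proof. by rewrite /dm metric_sym. Qed.

(* The diameter, capped at 1, of what remains of the path on [q, t]. *)
Let H q t : set R :=
  [set r | exists s s', [/\ S s, S s', q <= s <= t, q <= s' <= t & r = dm s s']]
  `|` [set 0].
Let h q t : R := sup (H q t).

Let H_sup q t : has_sup (H q t).
Proof.
split; first by exists 0; right.
by exists 1 => r [[s [s' [_ _ _ _ ->]]]|->]; [exact: dm_le1|exact: ler01].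
Qed.

Let h_ge0 q t : 0 <= h q t.
Proof. by apply: (sup_upper_bound (H_sup q t)); right. Qed.

Let dm_h q t s s' : S s -> S s' -> q <= s <= t -> q <= s' <= t ->
  dm s s' <= h q t.
Proof.
by move=> *; apply: (sup_upper_bound (H_sup q t)); left; exists s, s'.
Qed.

Let h_le q t (c : R) : 0 <= c ->
  (forall s s', S s -> S s' -> q <= s <= t -> q <= s' <= t -> s <= s' ->
     dm s s' <= c) -> h q t <= c.
Proof.
move=> c0 H1; apply: sup_le_ub; first by case: (H_sup q t).
move=> r [[s [s' [Ss Ss' qs qs' ->]]]|->//].
by have [ss|/ltW ss] := leP s s'; [|rewrite dmC]; exact: H1.
Qed.

Let h_le1 q t : h q t <= 1.
Proof. by apply: h_le => // *; exact: dm_le1. Qed.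

Let h_mono q t t' : t <= t' -> h q t <= h q t'.
Proof. by move=> tt'; apply: h_le => // s s' Ss Ss' *; apply: dm_h => //;
  lra. Qed.

(** When only [s'] exceeds [t], it is replaced by a point of [[s, t]] at cost less than [e]: by [t]
    itself or, if [t] was erased, by the left end [u] of its gap, whose image equals that of the
    right end [v <= s']. *)
Let h_mod (e d : R) : 0 < e ->
  (forall s t, `|s - t| < d -> mdist (f s) (f t) < e) ->
  forall q t t', t <= t' -> t' < t + d -> h q t' <= h q t + e.
Proof.
move=> e0 fd q t t' tt' t'd; apply: h_le => [|s s' Ss Ss' qs qs' ss'].
  by rewrite addr_ge0// ltW.
have h0 := h_ge0 q t.
have [s't|ts'] := leP s' t.
  by have := @dm_h q t s s' Ss Ss'; lra.
have [st|ts] := leP s t; last first.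
  have /fd : `|s - s'| < d by rewrite ltr_norml; lra.
  by have := dm_le s s'; lra.
suff [u [Su sut du]] : exists u, [/\ S u, s <= u <= t & mdist (f u) (f s') < e].
  have := dm_tri s s' u; have := @dm_h q t s u Ss Su; lra.
have [Ut|Ut] := pselect (U t).
  have st' : s < t by rewrite lt_neqAle st andbT; apply/eqP => ?; subst s;
    case: Ss.
  have [u [v [utv [su vs'] Su Sv fuv]]] := S_gap Ss Ss' Ut st' ts'.
  exists u; split=> //; first by lra.
  by rewrite fuv; apply: fd; rewrite ltr_norml; lra.
exists t; split; first by split=> //; case: Ss; case: Ss'; lra.
- lra.
- by apply: fd; rewrite ltr_norml; lra.
Qed.

(** By maximality [S] has no point strictly between [s] and [t], so passing from [s] to [t] only
    adds [t], whose image is that of [s]. *)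
Let h_gap s t q : S s -> S t -> s < t -> f s = f t -> h q t <= h q s.
Proof.
move=> Ss St st fst; apply: h_le => // u v Su Sv qu qv uv.
have h0 := h_ge0 q s.
have g w : S w -> w <= t -> w <= s \/ w = t.
  move=> Sw wt; have [?|sw] := leP w s; [by left|right].
  apply/eqP; rewrite eq_le wt leNgt; apply/negP => wt'.
  have [[s01 Us] [t01 Ut]] := (Ss, St); have [_ Uw] := Sw.
  by apply: Uw; apply: (mU _ st _ Us Ut fst); lra.
have dtt w : f w = f t -> dm w t = 0.
  by move=> wt; rewrite /dm wt mdistxx; apply/min_idPr.
have [us|ut] : u <= s \/ u = t by apply: g => //; lra.
  have [vs|vt] : v <= s \/ v = t by apply: g => //; lra.
    by apply: dm_h => //; lra.
  by rewrite vt /dm -fst; apply: dm_h => //; lra.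
have -> : v = t by lra.
by rewrite ut dtt.
Qed.

(** An enumeration of the rationals, with 0 at the numbers that code none. *)
Let q (n : nat) : R := ratr (odflt 0 (choice.unpickle n)).

(** Take a rational just after [s]: nothing lies between it and [s] in that order, so the diameter
    at [s] is 0. Up to [t] there is, besides [t], a point of [S] with another image: the rational
    itself or the right end of the gap around it. *)
Let h_strict s t : S s -> S t -> s < t -> f s <> f t ->
  exists n, h (q n) s < h (q n) t.
Proof.
move=> Ss St st fst.
have D0 : 0 < mdist (f s) (f t) by rewrite mdist_gt0; exact/eqP.
have [d d0 fd] := f_unif D0.
have [r] : exists r : rat, ratr r \in `]s, (Num.min t (s + d))[.
  by apply: rat_in_itvoo; rewrite lt_min st ltrDl.
rewrite in_itv /= lt_min => /and3P[sr rt rd].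
exists (choice.pickle r); rewrite /q choice.pickleK /=.
have fs u : s <= u -> u < s + d -> f u <> f t.
  move=> su us ut; have : mdist (f s) (f u) < mdist (f s) (f t).
    by apply: fd; rewrite ltr_norml; lra.
  by rewrite ut ltxx.
have [v [Sv rv fv]] : exists v, [/\ S v, ratr r <= v <= t & f v <> f t].
  have [Ur|Ur] := pselect (U (ratr r)); last first.
    exists (ratr r); split; [split=> //; case: Ss; case: St; lra|lra|].
    by apply: fs => //; lra.
  have [u [v [urv [su vt] Su Sv fuv]]] := S_gap Ss St Ur sr rt.
  exists v; split=> //; first by lra.
  by rewrite -fuv; apply: fs; lra.
have : h (ratr r) s <= 0 by apply: h_le => // u u' _ _; lra.
have : 0 < dm v t by rewrite lt_min ltr01 mdist_gt0; exact/eqP.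
have := @dm_h (ratr r) t v t Sv St rv; lra.
Qed.

Let w (n : nat) : R := 2^-1 ^+ n.

Let w_gt0 n : 0 < w n. Proof. by rewrite exprn_gt0// invr_gt0. Qed.

Let w_sum N : \sum_(n < N) w n <= 2.
Proof.
suff -> : \sum_(n < N) w n = 2 - 2 * w N by have := w_gt0 N; lra.
elim: N => [|N IH]; first by rewrite big_ord0 /w expr0; lra.
by rewrite big_ord_recr /= IH /w exprS; lra.
Qed.

(* All the [h (q n)] share a modulus of continuity with [f], so their weighted
   sum is continuous; it increases wherever the erased path moves. *)
Let P N t := \sum_(n < N) w n * h (q n) t.
Let theta t := sup (range (P ^~ t)).

Let P_sup t : has_sup (range (P ^~ t)).
Proof.
split; first by exists (P 0 t), 0.
exists 2 => _ [N _ <-]; apply: le_trans (w_sum N); apply: ler_sum => n _.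
by rewrite -[leRHS]mulr1 ler_wpM2l// ltW.
Qed.

Let P_mono N N' t : (N <= N')%N -> P N t <= P N' t.
Proof.
move=> /subnK <-; elim: (N' - N)%N => [|k IH]; first by rewrite add0n.
rewrite addSn (le_trans IH)// /P big_ord_recr /= lerDl.
by rewrite mulr_ge0// ltW.
Qed.

Let P_theta N t : P N t <= theta t.
Proof. by apply: (sup_upper_bound (P_sup t)); exists N. Qed.

Let theta_le t c : (forall N, P N t <= c) -> theta t <= c.
Proof.
by move=> Pc; apply: sup_le_ub; [case: (P_sup t)|move=> _ [N _ <-]].
Qed.

Let theta_leD t t' (c : R) : 0 <= c ->
  (forall n, h (q n) t <= h (q n) t' + c) -> theta t <= theta t' + c *+ 2.
Proof.
move=> c0 hc; apply: theta_le => N.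
apply: (@le_trans _ _ (\sum_(n < N) (w n * h (q n) t' + w n * c))).
  by apply: ler_sum => n _; rewrite -mulrDr ler_wpM2l// ltW.
rewrite big_split /= lerD//; first exact: P_theta.
by rewrite -mulr_suml -mulr_natl ler_wpM2r// w_sum.
Qed.

Let theta_mono t t' : t <= t' -> theta t <= theta t'.
Proof.
move=> tt'; rewrite -[leRHS]addr0 -(mul0rn _ 2); apply: theta_leD => // n.
by rewrite addr0; exact: h_mono.
Qed.

Let theta_gap s t : S s -> S t -> f s = f t -> theta s = theta t.
Proof.
wlog st : s t / s < t => [G|] Ss St fst.
  by have [?|?|->//] := ltgtP s t; [exact: G|apply/esym/G].
apply/eqP; rewrite eq_le theta_mono ?(ltW st)//=.
rewrite -[leRHS]addr0 -(mul0rn _ 2); apply: theta_leD => // n.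
by rewrite addr0; exact: h_gap.
Qed.

Let theta_strict s t : S s -> S t -> s < t -> f s <> f t -> theta s < theta t.
Proof.
move=> Ss St st fst; have [n hn] := h_strict Ss St st fst.
pose c := w n * (h (q n) t - h (q n) s).
have c0 : 0 < c by rewrite mulr_gt0 ?subr_gt0.
suff : theta s <= theta t - c by lra.
apply: theta_le => N.
(* Going up to [maxn N n.+1] makes the sum include the term [n], where it gains [c]. *)
apply: (@le_trans _ _ (P (maxn N n.+1) s)).
  by apply: P_mono; rewrite leq_maxl.
have nN : (n < maxn N n.+1)%N by rewrite leq_maxr.
suff : P (maxn N n.+1) s <= P (maxn N n.+1) t - c.
  by have := P_theta (maxn N n.+1) t; lra.
rewrite /P (bigD1 (Ordinal nN)) //= [X in _ <= X - _](bigD1 (Ordinal nN)) //=.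
have : \sum_(i < maxn N n.+1 | i != Ordinal nN) w i * h (q i) s <=
    \sum_(i < maxn N n.+1 | i != Ordinal nN) w i * h (q i) t.
  apply: ler_sum => i _; rewrite ler_wpM2l ?(ltW (w_gt0 i))//.
  exact: h_mono (ltW st).
by rewrite /c mulrBr; lra.
Qed.

Let theta_inj s t : S s -> S t -> theta s = theta t -> f s = f t.
Proof.
wlog st : s t / s < t => [G|] Ss St fst.
  by have [?|?|->//] := ltgtP s t; [exact: G|apply/esym/G].
by apply: contrapT => /(theta_strict Ss St st); rewrite fst ltxx.
Qed.

Let theta_continuous : continuous theta.
Proof.
move=> t; apply/cvgrPdist_lt => e e0.
have e4 : 0 < e / 4 by rewrite divr_gt0.
have [d d0 fd] := f_unif e4.
near=> t'.
have tt' : `|t - t'| < d by near: t'; exact: cvgr_dist_lt.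
have e40 := ltW e4.
have [le|/ltW le] := leP t t'.
  have : theta t' <= theta t + (e / 4) *+ 2.
    apply: theta_leD => // n; apply: (h_mod e4 fd) => //.
    by move: tt'; rewrite ltr_norml; lra.
  by have := theta_mono le; rewrite ltr_norml mulr2n; lra.
have : theta t <= theta t' + (e / 4) *+ 2.
  apply: theta_leD => // n; apply: (h_mod e4 fd) => //.
  by move: tt'; rewrite ltr_norml; lra.
by have := theta_mono le; rewrite ltr_norml mulr2n; lra.
Unshelve. all: by end_near. Qed.

Let L := theta 1 - theta 0.
Let L0 : 0 < L.
Proof. by rewrite subr_gt0; apply: theta_strict. Qed.

Let eta t := (theta t - theta 0) / L.

Let eta0 : eta 0 = 0. Proof. by rewrite /eta subrr mul0r. Qed.
Let eta1 : eta 1 = 1. Proof. by rewrite /eta divff// gt_eqF. Qed.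

Let eta_inj s t : S s -> S t -> eta s = eta t <-> f s = f t.
Proof.
move=> Ss St; split=> [|/(theta_gap Ss St)]; last by rewrite /eta => ->.
move=> /(mulIf (invr_neq0 (lt0r_neq0 L0)))/addIr; exact: theta_inj.
Qed.

Let eta_mono s t : s <= t -> eta s <= eta t.
Proof.
by move=> st; rewrite ler_pM2r ?invr_gt0// lerB//; exact: theta_mono.
Qed.

Let eta_continuous : continuous eta.
Proof.
move=> t; apply: cvgMl; apply: cvgB; first exact: theta_continuous.
exact: cvg_cst.
Qed.

(** If the value is taken inside an erased gap, the left end of the gap works as well: [eta] is
    monotone with equal values at both ends. *)
Let eta_surj y : 0 <= y <= 1 -> exists2 t, S t & eta t = y.
Proof.
move=> y01.
have [|x] := @IVT R eta 0 1 y ler01 (continuous_subspaceT eta_continuous).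
  by rewrite eta0 eta1 minEle maxEle ler01.
rewrite in_itv /= => x01 etax.
have [Ux|Ux] := pselect (U x); last by exists x.
have /andP[x0 x1] := U01 Ux.
have [u [v [/andP[ux xv] _ Su Sv fuv]]] := S_gap S0 S1 Ux x0 x1.
exists u => //; apply/eqP; rewrite -etax eq_le eta_mono ?(ltW ux)//=.
by rewrite (iffRL (eta_inj Su Sv) fuv) eta_mono ?(ltW xv).
Qed.

Let compact_S : compact S.
Proof.
have -> : S = `[0, 1]%classic `&` ~` U.
  by apply/seteqP; split=> x; rewrite /= in_itv.
by apply: compact_closedI; [exact: segment_compact|exact: open_closedC].
Qed.

Let f_continuous : continuous f.
Proof.
move=> t; apply/cvg_ballP => e e0; have [d d0 fd] := f_unif e0.
near=> t'; rewrite ballEmdist /=; apply: fd.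
by near: t'; exact: cvgr_dist_lt.
Unshelve. all: by end_near. Qed.

(** By [eta_inj], [eta t] and [f t] determine each other for [t] in [S]. Both directions of this
    correspondence have a compact graph, the image of [S], hence are continuous. *)
Lemma erased_path_arc : arc R (f 0) (f 1) (f @` S).
Proof.
pose T y := xget 0 [set t | S t /\ eta t = y].
have TP y : 0 <= y <= 1 -> S (T y) /\ eta (T y) = y.
  by move=> /eta_surj[t St ty];
    apply: (@xgetPex _ 0 [set t | S t /\ eta t = y]); exists t.
pose Q (x : M) := xget 0 [set t | S t /\ f t = x].
have QP (x : M) : (f @` S) x -> S (Q x) /\ f (Q x) = x.
  by move=> [t St tx]; apply: (@xgetPex _ 0 [set t | S t /\ f t = x]); exists t.
have eta01 t : S t -> 0 <= eta t <= 1.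
  by move=> [/andP[t0 t1] _]; rewrite -{1}eta0 -eta1 !eta_mono.
exists (f \o T), (eta \o Q); split.
- apply: (@compact_graph_continuous _ _ _ ((fun t => (eta t, f t)) @` S)).
  + exact: (@order_hausdorff _ R).
  + apply: continuous_compact => //; apply: continuous_subspaceT.
    exact: pair_continuous.
  + move=> y; rewrite /= in_itv /= => /TP[ST eT].
    by exists (T y) => //=; rewrite eT.
  + move=> y z /=; rewrite in_itv /= => /TP[ST eT] [t St [ty <-]].
    by apply/eta_inj => //; rewrite ty.
- apply: (@compact_graph_continuous _ _ _ ((fun t => (f t, eta t)) @` S)).
  + exact: metric_hausdorff.
  + apply: continuous_compact => //; apply: continuous_subspaceT.
    exact: pair_continuous.
  + by move=> x /QP[SQ fQ]; exists (Q x) => //=; rewrite fQ.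
  + move=> x z /QP[SQ fQ] [t St [tx <-]] /=.
    by apply/eta_inj => //; rewrite tx.
- apply/seteqP; split=> [z [y /=]|_ [t St <-]].
    by rewrite in_itv /= => /TP[ST eT] <-; exists (T y).
  have [STe eTe] := TP _ (eta01 _ St).
  exists (eta t); first by rewrite /= in_itv /= eta01.
  by apply/eta_inj.
- move=> y; rewrite in_itv /= => /TP[ST eT].
  have [SQ fQ] : S (Q (f (T y))) /\ f (Q (f (T y))) = f (T y).
    by apply: QP; exists (T y).
  by rewrite -[RHS]eT; apply/eta_inj.
- split=> /=; apply/eta_inj => //; rewrite ?eta0 ?eta1;
    by case: (TP 0) => [|//]; case: (TP 1) => //; rewrite ?lexx ?ler01.
Qed.

End path_to_arc.

Lemma path_arc (R : realType) (M : metricType R) (f : R -> M) :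
  (forall e : R, 0 < e -> exists2 d : R, 0 < d &
     forall s t, `|s - t| < d -> mdist (f s) (f t) < e) ->
  f 0 <> f 1 ->
  exists2 A : set M, A `<=` range f & arc R (f 0) (f 1) A.
Proof.
move=> fu f01; have [U lU mU] := maximal_loops fu.
by exists (f @` [set t | 0 <= t <= 1 /\ ~ U t]);
  [move=> _ [t _ <-]; exists t|exact: erased_path_arc].
Qed.

(** * Open connected sets are arcwise connected *)

Lemma connected_ind (T : topologicalType) (V : set T) (P : T -> Prop) a :
  connected V -> V a -> P a ->
  (forall y, V y -> exists2 N, nbhs y N &
     forall z z', V z -> N z -> V z' -> N z' -> P z -> P z') ->
  forall b, V b -> P b.
Proof.
move=> cV Va Pa loc b Vb.
suff VP : V `&` [set y | P y] = V by move: Vb; rewrite -VP => -[].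
apply: cV; first by exists a.
- exists (interior [set z | V z -> P z]); first exact: open_interior.
  apply/seteqP; split=> y [Vy Py]; split=> //; last exact: (interior_subset Py).
  have [N nN NP] := loc y Vy; apply: filterS (nN) => z Nz Vz.
  exact: (NP y z Vy (nbhs_singleton nN)).
- exists (~` interior [set z | V z -> ~ P z]).
    by apply: open_closedC; exact: open_interior.
  apply/seteqP; split=> y [Vy Py]; split=> //.
    by move=> /interior_subset; apply.
  apply: contrapT => nPy; apply: Py.
  have [N nN NP] := loc y Vy; apply: filterS (nN) => z Nz Vz Pz.
  by apply: nPy; apply: (NP z y) => //; exact: nbhs_singleton nN.
Qed.

Section chains.
Variables (R : realType) (M : metricType R).
Implicit Types (d e : R) (x y z : M) (s : seq M).

Definition step d : rel M := fun x y => mdist x y < d.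

Lemma connected_chain (V : set M) d x y : connected V -> 0 < d -> V x -> V y ->
  exists s, [/\ path (step d) x s, last x s = y & forall z, z \in s -> V z].
Proof.
move=> cV d0 Vx.
pose P y := exists s, [/\ path (step d) x s, last x s = y & forall z,
  z \in s -> V z].
apply: (connected_ind (P := P) cV Vx); first by exists [::].
move=> u Vu; exists (ball u (d / 2)); first by apply: nbhsx_ballx; lra.
move=> z z' Vz Bz Vz' Bz' [s [ps ls Vs]]; exists (rcons s z'); split.
- rewrite rcons_path ps ls /= /step.
  move: Bz Bz'; rewrite ballEmdist /= => Bz Bz'.
  by have := metric_triangle z u z'; rewrite (metric_sym z u); lra.
- by rewrite last_rcons.
- by move=> w; rewrite mem_rcons inE => /predU1P[->//|/Vs].
Qed.

(** Uniform local connectedness: two points near [p] lie in one small connected neighbourhood of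
    [p], and compactness makes the distance uniform, like a Lebesgue number. *)
Lemma connected_within (e : R) : compact [set: M] -> locally_connected M ->
  0 < e -> exists2 d, 0 < d & forall x y, mdist x y < d ->
    exists V : set M, [/\ connected V, V x, V y & forall z, V z ->
      mdist x z < e].
Proof.
move=> cM lM e0.
have e2 : 0 < e / 2 by lra.
move: cM; rewrite compact_near_coveringP.
move=> /(_ R (0^'+) (fun d x => forall y, mdist x y < d -> exists V : set M,
  [/\ connected V, V x, V y & forall z, V z -> mdist x z < e])) /(_ _ _)/=.
case=> [p _|d /= d0 Pd].
  have [V [oV Vp cV VB]] := lM p _ (nbhsx_ballx p _ e2).
  have : nbhs p V by exact: open_nbhs_nbhs.
  rewrite -nbhs_ballE => -[r /= r0]; rewrite ballEmdist => rV.
  have r2 : 0 < r / 2 by lra.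
  exists (ball p (r / 2), [set d | d < r / 2]).
    split=> /=; first exact: nbhsx_ballx.
    exact: nbhs_right_lt.
  move=> [x d] /= []; rewrite ballEmdist /= => px dr y xy.
  have VB' z : V z -> mdist p z < e / 2 by move=> /VB; rewrite ballEmdist.
  exists V; split=> //.
  - by apply: rV => /=; lra.
  - by apply: rV => /=; have := metric_triangle p x y; lra.
  - move=> z /VB' pz; have := metric_triangle x p z.
    have Vx : V x by apply: rV => /=; lra.
    by have := VB' _ Vx; rewrite (metric_sym x p); lra.
exists (d / 2); first by move: d0 => /=; lra.
move=> x y xy; have d20 : 0 < d / 2 by move: d0 => /=; lra.
apply: (Pd (d / 2)) => //=.
by rewrite sub0r normrN gtr0_norm//; move: d0 => /=; lra.
Qed.

Lemma bounded_choice (T : Type) (P : nat -> T -> Prop) (N : nat) (m : T ->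
  nat) :
  (forall i, exists t, P i t) ->
  exists (s : nat -> T) (k : nat), (forall i, P i (s i)) /\
    forall i, (i < N)%N -> (m (s i) <= k)%N.
Proof.
move=> /choice[s Ps]; exists s, (\max_(i < N) m (s i)); split=> // i iN.
exact: (leq_bigmax (Ordinal iN)).
Qed.

(* Subdividing every step into the same number [m] of substeps keeps the
   [n]-th polygon parametrized by a uniform grid of [0, 1]. *)
Lemma refine_chain (d d' e : R) (p : nat -> M) (N : nat) b :
  0 < d' -> 0 < e ->
  (forall x y, mdist x y < d -> exists V : set M,
    [/\ connected V, V x, V y & forall z, V z -> mdist x z < e]) ->
  (forall i, mdist (p i) (p i.+1) < d) -> (forall i, (N <= i)%N -> p i = b) ->
  exists (m : nat) (p' : nat -> M), [/\ (0 < m)%N, p' 0%N = p 0%N,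
    (forall i, (N * m <= i)%N -> p' i = b),
    (forall i, mdist (p (i %/ m)%N) (p' i) < e) &
    (forall i, mdist (p' i) (p' i.+1) < d')].
Proof.
move=> d'0 e0 cV pd pN.
have [i|s [k [Ps sk]]] := @bounded_choice (seq M) (fun i s =>
   [/\ path (step d') (p i) s, last (p i) s = p i.+1,
    (forall z, z \in s -> mdist (p i) z < e) & (N <= i)%N -> s = [::]]) N size.
  have [Ni|iN] := leqP N i.
    by exists [::]; split=> //=; rewrite !pN// leqW.
  have [V [cV' Vx Vy Ve]] := cV _ _ (pd i).
  have [s [ps ls sV]] := connected_chain cV' d'0 Vx Vy.
  by exists s; split=> // z /sV/Ve.
have {}sk i : (size (s i) <= k)%N.
  have [Ni|iN] := leqP N i; last exact: sk.
  by have [_ _ _ ->] := Ps i.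
pose m := k.+1.
(* Index [j] is substep [j %% m] of step [j %/ m]; once the inserted points run out, the default of
   [nth] waits at the next vertex. *)
pose p' j := nth (p (j %/ m)%N.+1) (p (j %/ m)%N :: s (j %/ m)%N) (j %% m)%N.
have p'last i j : (size (s i) <= j)%N -> nth (p i.+1) (p i :: s i) j = p i.+1.
  rewrite leq_eqVlt => /predU1P[<-|ij]; last by rewrite nth_default.
  by rewrite -last_nth; have [_ -> _ _] := Ps i.
exists m, p'; split=> //.
- move=> i; rewrite -leq_divRL// => Ni.
  have [_ _ _ /(_ Ni) s0] := Ps (i %/ m)%N.
  by rewrite /p' s0 !pN// ?leqW//; case: (i %% m)%N => //= j; rewrite nth_nil.
- move=> i; have [_ _ se _] := Ps (i %/ m)%N.
  rewrite /p'; case: (i %% m)%N => [|j] /=; first by rewrite mdistxx.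
  have [js|sj] := ltnP j (size (s (i %/ m)%N)); first by apply: se;
    exact: mem_nth.
  rewrite nth_default//.
  have [_ <- _ _] := Ps (i %/ m)%N.
  case: (lastP (s _)) se => [|s' z] se; first by rewrite /= mdistxx.
  by rewrite last_rcons; apply: se; rewrite mem_rcons mem_head.
- move=> i.
  have [ps _ _ _] := Ps (i %/ m)%N.
  have im : (i %% m < m)%N by rewrite ltn_mod.
  have [im'|im'] := ltnP (i %% m).+1 m.
    have [E1 E2] : (i.+1 %/ m = i %/ m /\ i.+1 %% m = (i %% m).+1)%N.
      have E : i.+1 = (i %/ m * m + (i %% m).+1)%N by rewrite addnS -divn_eq.
      split; first by rewrite E divnMDl// (divn_small im') addn0.
      by rewrite E modnMDl modn_small.
    rewrite /p' E1 E2.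
    have [si|si] := leqP (size (s (i %/ m)%N)) (i %% m).
      by rewrite !p'last ?mdistxx// leqW.
    move: ps => /(pathP (p (i %/ m)%N.+1))/(_ _ si).
    by rewrite /step.
  have {}im' : (i %% m)%N = k by apply/eqP; rewrite eqn_leq -ltnS im -ltnS im'.
  have [E1 E2] : (i.+1 %/ m = (i %/ m).+1 /\ i.+1 %% m = 0)%N.
    have E : i.+1 = ((i %/ m).+1 * m)%N.
      by rewrite {1}(divn_eq i m) im' -addnS mulSn addnC.
    by rewrite E mulnK// modnMl.
  rewrite {1}/p' im' p'last ?sk// /p' E1 E2 /=.
  by rewrite mdistxx.
Qed.

End chains.

Lemma truncn_divn (R : realType) (x : R) (m : nat) : (0 < m)%N ->
  Num.truncn x = (Num.truncn (m%:R * x) %/ m)%N.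
Proof.
move=> m0; suff E n : (n < Num.truncn x)%N = (n < Num.truncn (m%:R * x) %/ m)%N.
  apply/eqP; rewrite eqn_leq; apply/andP; split; rewrite leqNgt.
    by rewrite E ltnn.
  by rewrite -E ltnn.
rewrite Num.Theory.truncn_gt_nat leq_divRL// -[(n.+1 * m)%N]prednK ?muln_gt0//.
rewrite Num.Theory.truncn_gt_nat prednK ?muln_gt0// natrM mulrC.
by rewrite ler_pM2l// ltr0n.
Qed.

Lemma truncn_near (R : realType) (x y : R) : `|x - y| < 1 ->
  (Num.truncn x <= (Num.truncn y).+1)%N.
Proof.
rewrite ltr_norml => /andP[_ xy]; rewrite Num.Theory.truncn_le_nat.
have := Num.Theory.truncnS_gt y; rewrite -[in X in _ -> X]natr1.
by rewrite -[X in _ < X + _]natr1 -natr1; lra.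
Qed.

Section open_connected.
Variables (R : realType) (M : metricType R).
Hypotheses (cM : compact [set: M]) (lM : locally_connected M).
Variables (U : set M) (a b : M).
Hypotheses (oU : open U) (cU : connected U) (Ua : U a) (Ub : U b).

(** One [eta] has to serve every mesh [d], because the limit of the refined chains must stay inside
    [U]. The property spreads along [U]: small connected neighbourhoods prolong the chains, at the
    price of a smaller [eta]. *)
Lemma inner_chains : exists2 eta : R, 0 < eta & forall d : R, 0 < d ->
  exists s : seq M, [/\ path (step d) a s, last a s = b &
    forall z, z \in a :: s -> ball z eta `<=` U].
Proof.
pose P y := exists2 eta : R, 0 < eta & forall d : R, 0 < d ->
  exists s : seq M, [/\ path (step d) a s, last a s = y &
    forall z, z \in a :: s -> ball z eta `<=` U].
have oball y : U y -> exists2 r : R, 0 < r & ball y r `<=` U.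
  move=> Uy; have := open_nbhs_nbhs (conj oU Uy).
  by rewrite -nbhs_ballE => -[r /= r0 rU]; exists r.
apply: (connected_ind (P := P) cU Ua _ _ Ub).
  have [r r0 rU] := oball _ Ua; exists r => // d _; exists [::]; split=> // z.
  by rewrite inE => /eqP ->.
move=> y Uy; have [r r0 rU] := oball _ Uy.
have r2 : 0 < r / 2 by lra.
have [V [oV Vy cV Vr]] := lM (nbhsx_ballx y _ r2).
exists V; first exact: open_nbhs_nbhs.
move=> z z' _ Vz _ Vz' [eta eta0 ceta].
exists (Num.min eta (r / 2)); first by rewrite lt_min eta0.
move=> d d0; have [s [ps ls sU]] := ceta d d0.
have [s' [ps' ls' s'V]] := connected_chain cV d0 Vz Vz'.
exists (s ++ s'); split.
- by rewrite cat_path ps ls.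
- by rewrite last_cat ls.
- move=> w; rewrite -cat_cons mem_cat => /orP[/sU wU|/s'V/Vr].
    by apply: subset_trans wU; apply: le_ball; rewrite ge_min lexx.
  rewrite ballEmdist /= => yw v; rewrite ballEmdist /= lt_min => /andP[_ wv].
  apply: rU; rewrite ballEmdist /=.
  by have := metric_triangle y w v; lra.
Qed.

Let w (c : R) (n : nat) : R := c * 2^-1 ^+ n.

Let w_gt0 c n : 0 < c -> 0 < w c n.
Proof. by move=> c0; rewrite mulr_gt0// exprn_gt0// invr_gt0. Qed.

Let wS c n : w c n.+1 = w c n / 2.
Proof. by rewrite /w exprS; lra. Qed.

Let w_small c e : 0 < c -> 0 < e -> exists n, w c n < e.
Proof.
move=> c0 e0.
have [n _ nH] : \forall n \near \oo, (2^-1 : R) ^+ n < e / c.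
  have : (fun n => (2^-1 : R) ^+ n) @ \oo --> (0 : R).
    by apply: cvg_expr; rewrite ger0_norm ?invr_ge0//; lra.
  move=> /cvgrPdist_lt/(_ (e / c)); rewrite divr_gt0// => /(_ isT).
  apply: filterS => n; rewrite sub0r normrN ger0_norm//.
by exists n; rewrite /w mulrC -ltr_pdivlMr//; exact: (nH n (leqnn n)).
Qed.

(** The polygons [f n] are step functions, each within [w c n] of the next, so they converge
    uniformly; their jumps, smaller than [del n], make the limit uniformly continuous. *)
Lemma open_connected_path : exists f : R -> M,
  [/\ forall e : R, 0 < e -> exists2 d : R, 0 < d &
        forall s t, `|s - t| < d -> mdist (f s) (f t) < e,
      f 0 = a, f 1 = b & range f `<=` U].
Proof.
have [eta eta0 ceta] := inner_chains.
(* The limit strays from the first polygon by at most [2 * c], half of [eta]. *)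
pose c := eta / 4.
have c0 : 0 < c by rewrite /c; lra.
have [del delP] : exists del : nat ->
  R, forall n, [/\ 0 < del n, del n <= w c n &
    forall x y, mdist x y < del n -> exists V : set M,
    [/\ connected V, V x, V y & forall z, V z -> mdist x z < w c n]].
  have /choice[del] : forall n, exists d, [/\ 0 < d, d <= w c n &
      forall x y, mdist x y < d -> exists V : set M,
      [/\ connected V, V x, V y & forall z, V z -> mdist x z < w c n]].
    move=> n; have [d d0 dP] := connected_within cM lM (w_gt0 n c0).
    exists (Num.min d (w c n)); split; first by rewrite lt_min d0 w_gt0//.
      by rewrite ge_min lexx orbT.
    by move=> x y; rewrite lt_min => /andP[/dP].
  by exists del.
have del0 n : 0 < del n by case: (delP n).
pose I n (x : nat * (nat -> M)) := [/\ (0 < x.1)%N, x.2 0%N = a,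
  forall i, (x.1 <= i)%N -> x.2 i = b & forall i,
    mdist (x.2 i) (x.2 i.+1) < del n].
pose Q n (x y : nat * (nat -> M)) :=
  exists m, [/\ (0 < m)%N, y.1 = (x.1 * m)%N &
  forall i, mdist (x.2 (i %/ m)%N) (y.2 i) < w c n].
have [x0 [Ix0 x0U]] : exists x0, I 0%N x0 /\ forall i, ball (x0.2 i) eta `<=` U.
  have [s [ps ls sU]] := ceta _ (del0 0%N).
  have lastb i : (size s <= i)%N -> nth b (a :: s) i = b.
    rewrite leq_eqVlt => /predU1P[<-|si]; last by rewrite nth_default.
    by rewrite -last_nth.
  exists ((size s).+1, nth b (a :: s)); split.
    split=> //= i; first by move=> si; rewrite lastb// ltnW.
    have [si|si] := leqP (size s) i.
      by rewrite (lastb i)// nth_default// mdistxx.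
    by move/pathP: ps => /(_ b _ si).
  move=> i /=; have [si|si] := leqP (size s) i.
    rewrite lastb//; apply: sU; rewrite -ls; exact: mem_last.
  by apply: sU; rewrite mem_nth//= ltnW.
have /choice[g gP] : forall nx : nat * (nat * (nat -> M)), exists y,
    I nx.1 nx.2 -> I nx.1.+1 y /\ Q nx.1 nx.2 y.
  move=> [n x]; have [Ix|] := pselect (I n x); last by exists x.
  have [x10 x20 xN xd] := Ix; have [_ _ dP] := delP n.
  have [m [p' [m0 p'0 p'N p'e p'd]]] :=
    refine_chain (del0 n.+1) (w_gt0 n c0) dP xd xN.
  exists ((x.1 * m)%N, p') => _; split; last by exists m.
  by split=> //=; rewrite ?muln_gt0 ?x10 ?p'0.
pose X := fix X n := if n is n'.+1 then g (n', X n') else x0.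
have IX n : I n (X n) by elim: n => //= n IH; have [] := gP (n, X n) IH.
have QX n : Q n (X n) (X n.+1) by have [] := gP (n, X n) (IX n).
pose K n : R := (X n).1%:R.
have K0 n : 0 < K n by rewrite ltr0n; have [] := IX n.
pose f n (t : R) := (X n).2 (Num.truncn (K n * t)).
have fS n t : mdist (f n t) (f n.+1 t) < w c n.
  have [m [m0 Km Qm]] := QX n.
  rewrite /f (truncn_divn _ m0) mulrA (mulrC m%:R) -natrM -Km.
  exact: Qm.
have f_tail n k t : mdist (f n t) (f (n + k)%N t) <= 2 * (w c n - w c (n +
  k)%N).
  elim: k => [|k IH]; first by rewrite addn0 mdistxx subrr mulr0.
  have := metric_triangle (f n t) (f (n + k)%N t) (f (n + k).+1 t).
  by rewrite addnS wS; have := fS (n + k)%N t; lra.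
have /choice[F FP] : forall t, exists z, forall n, mdist (f n t) z <= 2 * w c n.
  move=> t; have [] := cM (F := (f^~ t) @ \oo); first exact: filterT.
  move=> z [_ clz]; exists z => n; apply/ler_addgt0Pr => e e0.
  have [||_ [[k /= nk <-] +]] := clz (f^~ t @` [set k | (n <= k)%N]) (ball z e).
  - by exists n => // k /= nk; exists k.
  - exact: nbhsx_ballx.
  rewrite ballEmdist /= => zk.
  have := metric_triangle (f n t) (f k t) z.
  have := f_tail n (k - n)%N t; rewrite subnKC// metric_sym.
  by rewrite (metric_sym (f k t) z); have := w_gt0 k c0; lra.
have F_eq t z : (forall n, f n t = z) -> F t = z.
  move=> fz; apply/eqP; rewrite eq_sym; apply: contrapT => /negP;
    rewrite -mdist_gt0 => d0.
  have [n] := w_small c0 (divr_gt0 d0 (ltr0n _ 2)).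
  by have := FP t n; rewrite fz; lra.
exists F; split.
(* Parameters closer than one cell have indices differing by at most 1. The error is [w c n] once
   and [2 * w c n] twice, whence the 5. *)
- move=> e e0; have [n wn] := w_small c0 (divr_gt0 e0 (ltr0n _ 5)).
  exists (K n)^-1; first by rewrite invr_gt0.
  move=> s t st.
  have st' : `|K n * s - K n * t| < 1.
    by rewrite -mulrBr normrM gtr0_norm// mulrC -ltr_pdivlMr// mul1r.
  have fst : mdist (f n s) (f n t) <= w c n.
    have [_ dw _] := delP n; have [_ _ _ Xd] := IX n.
    have := truncn_near st'; rewrite distrC in st'; have := truncn_near st'.
    rewrite /f; set i := Num.truncn _; set j := Num.truncn _ => ij ji.
    have w0 := ltW (w_gt0 n c0).
    have [ij'|ij'|->] := ltngtP i j; last by rewrite mdistxx.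
    + have -> : j = i.+1 by apply/eqP; rewrite eqn_leq ji ij'.
      by rewrite metric_sym (le_trans (ltW (Xd _))).
    + have -> : i = j.+1 by apply/eqP; rewrite eqn_leq ij ij'.
      by rewrite (le_trans (ltW (Xd _))).
  have := metric_triangle (F s) (f n s) (F t).
  have := metric_triangle (f n s) (f n t) (F t).
  rewrite (metric_sym (F s) (f n s)).
  by have := FP s n; have := FP t n; lra.
- by apply: F_eq => n; rewrite /f mulr0 Num.Theory.truncn0; have [] := IX n.
- apply: F_eq => n; rewrite /f mulr1 Num.Theory.natrK.
  by have [_ _ XN _] := IX n; exact: XN.
- move=> _ [t _ <-]; apply: (x0U (Num.truncn (K 0%N * t))).
  rewrite ballEmdist /=; have := FP t 0%N; rewrite /w expr0 /f /= /c; lra.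
Qed.

Lemma open_connected_arc : a <> b -> exists2 A, A `<=` U & arc R a b A.
Proof.
move=> ab; have [f [fu f0 f1 fU]] := open_connected_path.
have [|A Af aA] := path_arc fu; first by rewrite f0 f1.
by exists A; [exact: subset_trans fU|rewrite -f0 -f1].
Qed.

End open_connected.

(** * Compact metrizable spaces: separability and transfer along homeomorphisms *)

(** Otherwise the complements of the finite unions of the [N y] generate a proper filter without
    cluster point. *)
Lemma compact_finite_cover (X : topologicalType) (N : X -> set X) :
  compact [set: X] -> (forall x, nbhs x (N x)) ->
  exists2 E, finite_set E & forall x, exists2 y, E y & N y x.
Proof.
move=> cX nN; apply: contrapT => noE.
pose F : set_system X := [set B | exists2 E, finite_set E &
  forall x, (forall y, E y -> ~ N y x) -> B x].
have FF : ProperFilter F.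
  apply: Build_ProperFilter_ex => [B [E fE EB]|].
    apply: contrapT => nB; apply: noE; exists E => // x.
    apply: contrapT => nx; apply: nB; exists x; apply: EB => y Ey Nyx.
    by apply: nx; exists y.
  split; first by exists set0.
    move=> B C [E fE EB] [E' fE' EC]; exists (E `|` E').
      by rewrite finite_setU.
    by move=> x Hx; split; [apply: EB|apply: EC] => y Ey; apply: Hx;
      [left|right].
  by move=> B C BC [E fE EB]; exists E => // x /EB/BC.
have [x [_ clx]] := cX F FF filterT.
have [||y [yx Ny]] := clx (~` N x) (N x); [|exact: nN|exact: yx].
by exists [set x]; [exact: finite_set1|move=> y; apply].
Qed.

Lemma compact_metric_separable (R : realType) (M : metricType R) :
  compact [set: M] -> separable M.
Proof.
move=> cM.
have /choice[D DP] : forall n : nat, exists D : set M, finite_set D /\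
    forall x, exists2 y, D y & ball y (n.+1%:R^-1) x.
  move=> n; have n0 : (0 : R) < n.+1%:R^-1 by rewrite invr_gt0 ltr0n.
  have [x|E fE EN] := compact_finite_cover (N := fun x => ball x n.+1%:R^-1) cM.
    exact: nbhsx_ballx.
  by exists E.
exists (\bigcup_n D n).
  by apply: bigcup_countable => // n _; apply: finite_set_countable;
    have [] := DP n.
move=> V [x Vx] oV; have := open_nbhs_nbhs (conj oV Vx).
rewrite -nbhs_ballE => -[r /= r0 rV].
have [n nr] : exists n : nat, n.+1%:R^-1 < r.
  exists (Num.truncn r^-1); rewrite invf_plt ?posrE// ?ltr0n//.
  exact: Num.Theory.truncnS_gt.
have [y Dy yx] := (DP n).2 x; exists y; split; last by exists n.
by apply: rV; apply/ball_sym; apply: le_ball yx; exact: ltW.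
Qed.

Section homeomorphic_metric.
Variables (R : realType) (X : topologicalType) (M : metricType R).
Variables (f : X -> M) (g : M -> X).
Hypotheses (cf : continuous f) (cg : continuous g).
Hypotheses (fK : cancel f g) (gK : cancel g f).

Lemma homeo_imageE (U : set X) : f @` U = g @^-1` U.
Proof.
apply/seteqP; split=> [_ [x Ux <-]|y Uy]; first by rewrite /= fK.
by exists (g y); rewrite ?gK.
Qed.

Lemma homeo_open (U : set X) : open U -> open (f @` U).
Proof. by rewrite homeo_imageE => oU; apply: open_comp => // x _;
  exact: cg. Qed.

Lemma homeo_connected (U : set X) : connected U -> connected (f @` U).
Proof.
move=> cU; apply: connected_continuous_connected => //.
exact: continuous_subspaceT.
Qed.

Lemma homeo_compact : compact [set: X] -> compact [set: M].
Proof.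
move=> cX; have -> : [set: M] = f @` setT by rewrite homeo_imageE preimage_setT.
by apply: continuous_compact => //; exact: continuous_subspaceT.
Qed.

Lemma homeo_locally_connected : locally_connected X -> locally_connected M.
Proof.
move=> lX y U nU.
have [|V [oV Vy cV VU]] := lX (g y) (f @^-1` U).
  by apply: cf; rewrite gK.
exists (f @` V); split; [exact: homeo_open|by exists (g y); rewrite ?gK| |].
  exact: homeo_connected.
by move=> _ [x /VU ? <-].
Qed.

Lemma homeo_arc a b A : arc R (f a) (f b) A -> arc R a b (g @` A).
Proof.
move=> [p [q [cp cq pA pq [p0 p1]]]].
exists (g \o p), (q \o f); split.
- apply/subspace_continuousP => t t01.
  have pt := iffLR (subspace_continuousP _ _) cp t t01.
  exact: (cvg_comp _ _ pt (@cg (p t))).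
- apply/subspace_continuousP => _ [y Ay <-] U nU.
  have {}nU : nbhs (q y) U by move: nU; rewrite /from_subspace /= gK.
  have qy := iffLR (subspace_continuousP _ _) cq y Ay _ nU.
  have : nbhs (g y) (f @^-1` [set z | A z -> (q @^-1` U) z]).
    by apply: cf; rewrite gK.
  by apply: filterS => x /= H [z Az zx]; apply: H; rewrite -zx gK.
- by rewrite -pA image_comp.
- by move=> t t01 /=; rewrite gK pq.
- by rewrite /= p0 p1 !fK.
Qed.

End homeomorphic_metric.

Lemma open_connected_arcX (R : realType) (X : topologicalType) (U : set X) a b :
  compact [set: X] -> locally_connected X -> metrizable R X ->
  open U -> connected U -> U a -> U b -> a <> b ->
  exists2 A, A `<=` U & arc R a b A.
Proof.
move=> cX lX [M [f [g [cf cg fK gK]]]] oU cU Ua Ub ab.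
have [|||||A AU aA] := @open_connected_arc R M (homeo_compact cf fK gK cX)
  (homeo_locally_connected cf cg fK gK lX) (f @` U) (f a) (f b).
- exact: (homeo_open cg fK gK).
- exact: homeo_connected.
- by exists a.
- by exists b.
- by move=> /(can_inj fK).
- exists (g @` A); last exact: (homeo_arc cf cg fK gK aA).
  by move=> _ [y /AU[x Ux <-] <-]; rewrite fK.
Qed.

Lemma compact_metrizable_separable (R : realType) (X : topologicalType) :
  compact [set: X] -> metrizable R X -> separable X.
Proof.
move=> cX [M [f [g [cf cg fK gK]]]].
have [D cD dD] := compact_metric_separable (homeo_compact cf fK gK cX).
exists (g @` D); first exact: sub_countable (card_image_le _ _) cD.
move=> V [x Vx] oV; have [||y [[z Vz <-] Dz]] := dD (f @` V).
- by exists (f x), x.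
- exact: (homeo_open cg fK gK).
by exists z; split=> //; exists (f z).
Qed.

(** * Betweenness relations and back-and-forth *)

Section pretree.
Variables (T : eqType) (same : T -> T -> T -> Prop).
Hypothesis same_sym : forall c a b, same c a b -> same c b a.
Hypothesis same_trans : forall c b a d, same c a b -> same c b d -> same c a d.
Hypothesis same_irr : forall c b, ~ same c c b.
Hypothesis same_refl : forall c a, a <> c -> same c a a.
Hypothesis same_cross : forall c d z, c <> d -> ~ same c d z -> same d c z.
Implicit Types (a b c d m n r z : T) (F : seq T).

(** [~ same m a b] means that [m] lies on the segment from [a] to [b], ends included, so [m] is a
    common point of three segments. *)
Definition med m a b c := [/\ ~ same m a b, ~ same m b c & ~ same m a c].

Lemma same_neq c a b : same c a b -> a <> c.
Proof. by move=> + ac; rewrite ac => /same_irr. Qed.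

Lemma same_neqr c a b : same c a b -> b <> c.
Proof. by move=> /same_sym/same_neq. Qed.

Lemma same_eql c a b d : same c a b -> same c a d <-> same c b d.
Proof. by move=> ab; split; apply: same_trans => //; exact: same_sym. Qed.

Lemma between_tri m b a c : ~ same m a c -> ~ same m a b \/ ~ same m b c.
Proof.
move=> ac; have [ab|] := pselect (same m a b); last by left.
by right=> bc; apply: ac; exact: same_trans bc.
Qed.

Lemma between_anti a b z : ~ same a b z -> ~ same b a z -> a = b.
Proof. by move=> abz baz; apply: contrapT => /same_cross/(_ abz). Qed.

(** Seen from a root [r], [~ same a r b] says that [a] precedes [b] in the tree order; this is its
    transitivity. *)
Lemma between_trans r a b c : ~ same a r b -> ~ same b r c -> ~ same a r c.
Proof.
move=> arb brc arc; have [ab|ab] := pselect (a = b); first by rewrite ab in arc.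
have bar : same b a r by apply: same_cross ab _ => /same_sym.
have bac : same b a c.
  apply: same_cross ab _ => abc; apply: arb.
  by apply: same_trans arc _; exact: same_sym.
by apply: brc; exact: same_trans (same_sym bar) bac.
Qed.

(** If [m] and [m'] differ, at least two of the three points are off the side of [m] containing
    [m']. By [same_cross] both are on the side of [m'] containing [m], although [m'] separates
    them. *)
Lemma med_unique m m' a b c : med m a b c -> med m' a b c -> m = m'.
Proof.
move=> [ab bc ac] [ab' bc' ac']; apply: contrapT => mm'.
have two x y : ~ same m' x y -> ~ same m m' x -> ~ same m m' y -> False.
  move=> xy mx my; apply: xy.
  by apply: same_trans (same_sym (same_cross mm' mx)) (same_cross mm' my).
have one x y : ~ same m x y -> ~ same m m' x \/ ~ same m m' y.
  move=> xy; have [mx|] := pselect (same m m' x); last by left.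
  by right=> my; apply: xy; exact: same_trans (same_sym mx) my.
have [?|?] := one _ _ ab; have [?|?] := one _ _ bc; have [?|?] := one _ _ ac.
all: first [by exact: (two a b)|by exact: (two b c)|by exact: (two a c)].
Qed.

Lemma leaf_same r m c d : ~ same m r c -> ~ same m r d -> r <> m -> same r c d.
Proof.
move=> rc rd rm.
have cr z : ~ same m r z -> same r m z.
  by move=> mz; apply: same_cross => // mr; apply: rm.
exact: same_trans (same_sym (cr _ rc)) (cr _ rd).
Qed.

Lemma leaf_same_at r m c d : ~ same m r c -> ~ same m r d ->
  same c r d <-> same c m d.
Proof.
move=> rc rd; have [cm|cm] := pselect (c = m).
  by rewrite cm; split=> // /same_irr.
by apply: same_eql; apply: same_sym; apply: same_cross => [?|/same_sym//];
  apply: cm.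
Qed.

Section edge.
Variables (r a b : T).
Hypotheses (rab : ~ same r a b) (ra : r <> a) (rb : r <> b).

Lemma edge_samel : same a r b. Proof. exact: same_cross. Qed.

Lemma edge_samer : same b r a.
Proof. by apply: same_cross => // /same_sym. Qed.

Lemma edge_sidel c : ~ same a b c <-> ~ same a r c.
Proof. by rewrite (same_eql _ edge_samel). Qed.

Lemma edge_sider c : ~ same b a c <-> ~ same b r c.
Proof. by rewrite (same_eql _ edge_samer). Qed.

Lemma edge_left c : ~ same a b c -> same r a c.
Proof. by move=> /edge_sidel arc; apply: same_cross => // ?; apply: ra. Qed.

Lemma edge_right c : ~ same b a c -> same r b c.
Proof. by move=> /edge_sider brc; apply: same_cross => // ?; apply: rb. Qed.

(** A point beyond [a] is seen from [r] in the direction of [a], one beyond [b] in that of [b], and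
    [r] separates these directions. *)
Lemma edge_same c d : ~ same a b c \/ ~ same b a c ->
  ~ same a b d \/ ~ same b a d ->
  same r c d <-> (~ same a b c /\ ~ same a b d) \/ (~ same b a c /\ ~ same b a
    d).
Proof.
have lr x y : ~ same a b x -> ~ same b a y -> ~ same r x y.
  move=> /edge_left ax /edge_right bY xy; apply: rab.
  exact: same_trans (same_trans ax xy) (same_sym bY).
move=> sc sd; split=> [cd|[[/edge_left ac /edge_left ad]|[/edge_right bc
  /edge_right bd]]].
- case: sc sd => cs [ds|ds]; [by left|by case: (lr _ _ cs ds)| |by right].
  by case: (lr _ _ ds cs); exact: same_sym.
- exact: same_trans (same_sym ac) ad.
- exact: same_trans (same_sym bc) bd.
Qed.

Lemma edge_neq_vertex c : ~ same a b c \/ ~ same b a c -> r <> c.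
Proof.
move=> sc rc; have : same r c c; last by rewrite -rc => /same_irr.
by apply/edge_same => //; case: sc; [left|right].
Qed.

(** Seen from [c], the new point [r] lies in the direction of an old one: [b] from [a], [a] from
    [b], and otherwise the end of the edge nearer to [c]. *)
Lemma edge_same_at c d : ~ same a b c \/ ~ same b a c ->
  same c r d <-> if c == a then same a b d
                 else if c == b then same b a d
                 else if pselect (~ same a b c) then same c a d else same c b d.
Proof.
move=> sc; case: eqP => [->|ca]; first exact: same_eql edge_samel.
case: eqP => [->|cb]; first exact: same_eql edge_samer.
case: pselect => [/= ac|/= /contrapT bc].
  move/edge_sidel: ac => ac.
  by apply: same_eql; apply: same_sym; apply: same_cross => [?|/same_sym//];
    apply: ca.
have {}sc : ~ same b a c by case: sc.
move/edge_sider: sc => sc.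
by apply: same_eql; apply: same_sym; apply: same_cross => [?|/same_sym//];
  apply: cb.
Qed.

End edge.

Section position.
Variable r : T.
Notation "a <=r b" := (~ same a r b) (at level 70).

Lemma minimal_below (s : seq T) c : c <> r -> {in s, forall x, x <> r} ->
  exists2 a, a \in c :: s & a <=r c /\
    forall x, x \in c :: s -> x <=r a -> x = a.
Proof.
have refl a : a <> r -> a <=r a by move=> ar /same_sym/same_irr.
elim: s c => [|y s IH] c cr sr.
  by exists c; [exact: mem_head|split=> [|x];
    [exact: refl|rewrite inE => /eqP]].
have [x xs|a acs [ac mina]] := IH c cr; first by apply: sr; rewrite inE xs orbT.
have acs' : a \in c :: y :: s.
  by move: acs; rewrite !inE => /orP[->|->]; rewrite ?orbT.
have [ya|ya] := pselect (y <=r a).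
- exists y; first by rewrite !inE eqxx orbT.
  split=> [|x]; first exact: between_trans ac.
  rewrite inE => /orP[xc|]; last rewrite inE => /orP[/eqP//|xs].
  + move=> xy; have xa : x = a.
      by apply: mina; [rewrite inE xc|exact: between_trans ya].
    by rewrite xa; apply: (@between_anti _ _ r);
      [rewrite -xa => /same_sym|move=> /same_sym].
  + move=> xy; have xa : x = a.
      by apply: mina; [rewrite inE xs orbT|exact: between_trans ya].
    by rewrite xa; apply: (@between_anti _ _ r);
      [rewrite -xa => /same_sym|move=> /same_sym].
- exists a => //; split=> // x; rewrite inE => /orP[xc|].
    by apply: mina; rewrite inE xc.
  rewrite inE => /orP[/eqP -> /ya//|xs].
  by apply: mina; rewrite inE xs orbT.
Qed.

Definition med_closed F := forall a b c, a \in F -> b \in F -> c \in F ->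
  exists2 m, m \in F & med m a b c.

(* In the tree order rooted at [r], three minimal elements of [F] would have a
   median in [F] below two of them: there are at most two minimal elements. *)
Lemma position F n0 : n0 \in F -> r \notin F -> med_closed F ->
  (exists2 m, m \in F & {in F, forall c, ~ same m r c}) \/
  (exists a b, [/\ a \in F, b \in F, a <> b,
    {in F, forall c, ~ same a r c \/ ~ same b r c} &
    (same a r b /\ same b r a) /\
    forall n, n \in F -> ~ same n r a -> ~ same n r b -> False]).
Proof.
move=> n0F rF mF.
have Fr x : x \in F -> x <> r by move=> xF xr; rewrite -xr xF in rF.
have below c : c \in F -> exists2 a, a \in F & a <=r c /\
    forall x, x \in F -> x <=r a -> x = a.
  move=> cF; have [a acF [ac mina]] := minimal_below (Fr _ cF) Fr.
  exists a; first by move: acF; rewrite inE => /predU1P[->|].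
  by split=> // x xF; apply: mina; rewrite inE xF orbT.
have [a aF [_ mina]] := below _ n0F.
have [all_a|] := pselect {in F, forall c, ~ same a r c}; first by left;
  exists a.
move=> /existsNP[c /not_implyP[cF /contrapT ac]].
have [b bF [bc minb]] := below _ cF.
have ab : a <> b by move=> ab; apply: bc; rewrite -ab.
right; exists a, b; split=> //.
- move=> d dF; have [e eF [ed mine]] := below _ dF.
  have [->|ea] := pselect (a = e); first by left.
  have [->|eb] := pselect (b = e); first by right.
  have [m mF' [mab mbe mae]] := mF _ _ _ aF bF eF.
  have tri x y : ~ same m x y -> (forall z, z \in F -> z <=r x -> z = x) ->
      (forall z, z \in F -> z <=r y -> z = y) -> m = x \/ m = y.
    move=> mxy minx miny; have [mxr|mry] := between_tri r mxy.
      by left; apply: minx => // /same_sym.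
    by right; exact: miny.
  have [m1|m1] := tri _ _ mab mina minb.
    have [m2|m2] := tri _ _ mbe minb mine; [by case: ab; rewrite -m1|].
    by case: ea; rewrite -m1.
  have [m2|m2] := tri _ _ mae mina mine; [by case: ab; rewrite -m1 -m2|].
  by case: eb; rewrite -m1.
split; last first.
  by move=> n nF na nb; apply: ab; rewrite -(mina _ nF na) -(minb _ nF nb).
split; apply: contrapT => abr; apply: ab; first exact: minb.
by apply/esym; exact: mina.
Qed.

End position.


Lemma med_closed_cons r F : med_closed F ->
  (forall a b, a \in F -> b \in F -> exists2 m, m \in r :: F & med m r a b) ->
  med_closed (r :: F).
Proof.
move=> mF mr.
have irr' x y : ~ same x y x by move=> /same_sym/same_irr.
have F' x : x \in F -> x \in r :: F by rewrite inE orbC => ->.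
have rr : r \in r :: F by exact: mem_head.
move=> a b c; rewrite !inE => /predU1P[->|aF] /predU1P[->|bF] /predU1P[->|cF].
- by exists r => //; split=> // /same_irr.
- by exists r => //; split=> // /same_irr.
- by exists r => //; split=> // /same_irr.
- by have [m mF' [? ? ?]] := mr _ _ bF cF; exists m.
- by exists r => //; split=> // /same_irr.
- have [m mF' [ra ac rc]] := mr _ _ aF cF; exists m => //; split=> //.
  by move=> /same_sym.
- have [m mF' [ra ab rb]] := mr _ _ aF bF; exists m => //; split=> //.
    by move=> /same_sym.
  by move=> /same_sym.
- by have [m mF' ?] := mF _ _ _ aF bF cF; exists m => //; exact: F'.
Qed.

(** * Finite partial isomorphisms and their extension by one point *)

Section partial_isomorphisms.
Variables (I : Type) (ord : T -> I) (P : I -> Prop).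
Implicit Types (L : seq (T * T)) (p q s : T * T).

Definition iso L := forall p q s, p \in L -> q \in L -> s \in L ->
  same p.1 q.1 s.1 <-> same p.2 q.2 s.2.

Definition good L :=
  [/\ iso L, {in L, forall p, ord p.1 = ord p.2} & med_closed (unzip1 L)].

Lemma iso_eq L p q : iso L -> p \in L -> q \in L -> p.1 = q.1 <-> p.2 = q.2.
Proof.
move=> iL pL qL; have := iL _ _ _ pL qL qL => E.
have ne x y : x = y <-> ~ same x y y.
  split=> [->|xy]; first exact: same_irr.
  by apply: contrapT => ne; apply: xy; apply: same_refl => yx; apply: ne.
by rewrite !ne E.
Qed.

Lemma good_flip L : good L -> good [seq (p.2, p.1) | p <- L].
Proof.
move=> [iL oL mL]; split.
- by move=> _ _ _ /mapP[p pL ->] /mapP[q qL ->] /mapP[s sL ->];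
    apply: iff_sym; exact: iL.
- by move=> _ /mapP[p pL ->] /=; rewrite oL.
- rewrite /unzip1 -map_comp =>
    _ _ _ /mapP[p pL ->] /mapP[q qL ->] /mapP[s sL ->] /=.
  have [|||m /mapP[t tL ->] [pq qs ps]] := mL p.1 q.1 s.1; try exact: map_f.
  exists t.2; first by apply/mapP; exists t.
  by split; apply: contra_not (iffRL (iL _ _ _ _ _ _)) _ => //.
Qed.

Lemma iso_cons L r r' : iso L ->
  {in L, forall p, r <> p.1 /\ r' <> p.2} ->
  {in L &, forall p q, same r p.1 q.1 <-> same r' p.2 q.2} ->
  {in L &, forall p q, same p.1 r q.1 <-> same p.2 r' q.2} ->
  iso ((r, r') :: L).
Proof.
move=> iL nL rL Lr p q s; rewrite !inE.
have irr' x y : same x y x <-> False by split=> // /same_sym/same_irr.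
have irr x y : same x x y <-> False by split=> // /same_irr.
move=> /predU1P[->|pL] /predU1P[->|qL] /predU1P[->|sL] /=; rewrite ?irr ?irr'//.
- exact: rL.
- by split=> _; apply: same_refl; have [] := nL _ pL.
- exact: Lr.
- by split=> /same_sym/(Lr _ _ pL qL)/same_sym.
- exact: iL.
Qed.

(** Seen from [r] the whole domain is on one side, and seen from a domain point [r] looks like
    [m.1], so nothing new has to be matched; medians with [r] are medians with [m.1]. *)
Lemma good_leaf L (m : T * T) r r' : good L -> m \in L -> ord r = ord r' ->
  r <> m.1 -> r' <> m.2 ->
  {in L, forall p, ~ same m.1 r p.1} -> {in L, forall p, ~ same m.2 r' p.2} ->
  good ((r, r') :: L).
Proof.
move=> [iL oL mL] mL' rr' rm rm' Lr Lr'; split.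
- apply: iso_cons => // [p pL|p q pL qL|p q pL qL].
  + split=> E; [move: (Lr _ pL)|move: (Lr' _ pL)]; rewrite -E; apply;
      exact: same_refl.
  + by split=> _; [apply: leaf_same (Lr' _ pL) (Lr' _ qL) _|
                   apply: leaf_same (Lr _ pL) (Lr _ qL) _].
  + rewrite (leaf_same_at (Lr _ pL) (Lr _ qL)).
    by rewrite (leaf_same_at (Lr' _ pL) (Lr' _ qL)); exact: iL.
- by move=> p; rewrite inE => /predU1P[->//|]; exact: oL.
- apply: med_closed_cons => // a b aF bF.
  have [n nF [ma ab mb]] := mL _ _ _ (map_f fst mL') aF bF.
  exists n; first by rewrite inE nF orbT.
  move: aF bF ma mb ab => /mapP[p pL ->] /mapP[q qL ->] np nq npq.
  split=> // /same_sym.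
  + by apply: between_trans (contra_not (@same_sym _ _ _) np) _ => /same_sym;
      exact: Lr.
  + by apply: between_trans (contra_not (@same_sym _ _ _) nq) _ => /same_sym;
      exact: Lr.
Qed.

(** Each domain point is beyond one end of the edge, so the old relations determine those of [r]. A
    median of [r], [c], [d] is [r] when [r] separates [c] from [d], and otherwise the median of [c],
    [d] and the end beyond which both lie. *)
Lemma good_edge L p q r r' : good L -> p \in L -> q \in L -> ord r = ord r' ->
  ~ same r p.1 q.1 -> r <> p.1 -> r <> q.1 ->
  ~ same r' p.2 q.2 -> r' <> p.2 -> r' <> q.2 ->
  {in L, forall s, ~ same p.1 q.1 s.1 \/ ~ same q.1 p.1 s.1} ->
  good ((r, r') :: L).
Proof.
move=> [iL oL mL] pL qL rr' rpq rp rq rpq' rp' rq' sL.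
have sL' : {in L, forall s, ~ same p.2 q.2 s.2 \/ ~ same q.2 p.2 s.2}.
  by move=> s sL1; rewrite -!iL//; exact: sL.
split.
- apply: iso_cons => // [s sL1|s t sL1 tL1|s t sL1 tL1].
  + by split; [apply: edge_neq_vertex (sL _ sL1)|apply:
      edge_neq_vertex (sL' _ sL1)].
  + rewrite (edge_same rpq rp rq (sL _ sL1) (sL _ tL1)).
    by rewrite (edge_same rpq' rp' rq' (sL' _ sL1) (sL' _ tL1)) -!iL.
  + rewrite (edge_same_at rpq rp rq _ (sL _ sL1)).
    rewrite (edge_same_at rpq' rp' rq' _ (sL' _ sL1)).
    rewrite (_ : (s.2 == p.2) = (s.1 == p.1)); last first.
      by apply/eqP/eqP => /(iso_eq iL sL1 pL).
    rewrite (_ : (s.2 == q.2) = (s.1 == q.1)); last first.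
      by apply/eqP/eqP => /(iso_eq iL sL1 qL).
    case: eqP => _; first exact: iL.
    case: eqP => _; first exact: iL.
    case: pselect => /= c1; case: pselect => /= c2; try exact: iL.
      by case: c2; rewrite -iL.
    by case: c1; rewrite iL.
- by move=> s; rewrite inE => /predU1P[->//|]; exact: oL.
- apply: med_closed_cons => // c d cF dF.
  have pF := map_f fst pL; have qF := map_f fst qL.
  have side a b : a \in unzip1 L -> ~ same r a b -> r <> a -> r <> b ->
      ~ same a b c -> ~ same a b d ->
        exists2 m, m \in r :: unzip1 L & med m r c d.
    move=> aF rab ra rb ac ad.
    have [n nF [nac ncd nad]] := mL _ _ _ aF cF dF.
    exists n; first by rewrite inE nF orbT.
    split=> // /same_sym.
    + apply: between_trans (contra_not (@same_sym _ _ _) nac) _ => /same_sym.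
      exact/(edge_sidel rab ra).
    + apply: between_trans (contra_not (@same_sym _ _ _) nad) _ => /same_sym.
      exact/(edge_sidel rab ra).
  move: (cF) (dF) => /mapP[s sL1 cs] /mapP[t tL1 dt].
  have sc := sL _ sL1; have sd := sL _ tL1; rewrite -cs -dt in sc sd.
  have rqp : ~ same r q.1 p.1 by move=> /same_sym.
  have [cd|cd] := pselect (same r c d); last first.
    by exists r; [exact: mem_head|split=> // /same_irr].
  have [[? ?]|[? ?]] := (edge_same rpq rp rq sc sd).1 cd.
    exact: (side p.1 q.1).
  exact: (side q.1 p.1).
Qed.

Hypothesis leaf_realized : forall L (m : T * T) r, good L -> m \in L ->
  P (ord r) ->
  r <> m.1 -> {in L, forall p, ~ same m.1 r p.1} ->
  exists r', [/\ ord r = ord r', r' <> m.2 & {in L, forall p,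
    ~ same m.2 r' p.2}].
Hypothesis edge_realized : forall a b i, a <> b -> P i ->
  exists r, [/\ i = ord r, r <> a, r <> b & ~ same r a b].
Hypothesis med_exists : forall a b c, exists m, med m a b c.
Hypothesis med_ord : forall m a b c,
  med m a b c -> m <> a -> m <> b -> m <> c -> P (ord m).

(** By [position], a new [r] hangs off a vertex or sits over an edge from [p.1] to [q.1]. In the
    second case the median [n] of [p.1], [q.1], [r] is first inserted into the edge; then [r] is [n]
    or a leaf at [n]. *)
Lemma good_extend L r p0 : good L -> p0 \in L -> P (ord r) ->
  exists L', [/\ good L', {subset L <= L'} & exists r', (r, r') \in L'].
Proof.
move=> gL p0L Pr.
have [/mapP[p pL rp]|rF] := boolP (r \in unzip1 L).
  by exists L; split=> //; exists p.2; rewrite rp -surjective_pairing.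
have sub x : {subset L <= x :: L} by move=> y yL; rewrite inE yL orbT.
have leaf L1 (m : T * T) : good L1 -> {subset L <= L1} -> m \in L1 ->
  r <> m.1 ->
    {in L1, forall p, ~ same m.1 r p.1} ->
    exists L', [/\ good L', {subset L <= L'} & exists r', (r, r') \in L'].
  move=> gL1 LL1 mL1 rm Lr.
  have [r' [rr' rm' Lr']] := leaf_realized gL1 mL1 Pr rm Lr.
  exists ((r, r') :: L1); split; first exact: good_leaf gL1 mL1 _ _ _ _ _.
    by move=> y /LL1 yL; rewrite inE yL orbT.
  by exists r'; exact: mem_head.
have [_ _ mL] := gL.
have Fr x : x \in unzip1 L -> r <> x by move=> xF rx; rewrite rx xF in rF.
have [[_ /mapP[m mL' ->] mr]|] := position (map_f fst p0L) rF mL.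
  apply: (leaf L m) => //; first by apply: Fr; exact: map_f.
  by move=> p pL; apply: mr; exact: map_f.
move=> [_ [_ [/mapP[p pL ->] /mapP[q qL ->] pq side [[prq qrp] no]]]].
have [n [npq nqr npr]] := med_exists p.1 q.1 r.
have nF x : x \in unzip1 L -> n <> x.
  move=> + nx; rewrite -nx => {}nF.
  by apply: (no n nF); [move=> /same_sym|move=> /same_sym].
have np := nF _ (map_f fst pL); have nq := nF _ (map_f fst qL).
have Pn : P (ord n).
  by have [->//|nr] := pselect (n = r); apply: (@med_ord n p.1 q.1 r).
have pq2 : p.2 <> q.2 by have [iL _ _] := gL; move=> /(iso_eq iL pL qL).
have [n' [nn' np' nq' npq']] := edge_realized pq2 Pn.
have gL1 : good ((n, n') :: L).
  apply: (good_edge gL pL qL) => // s sL.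
  have [ps|qs] := side _ (map_f fst sL); [left|right].
    by move/(same_eql _ (same_sym prq)).
  by move/(same_eql _ (same_sym qrp)).
have [nr|nr] := pselect (n = r).
  exists ((n, n') :: L); split=> //.
  by exists n'; rewrite -nr mem_head.
apply: (leaf ((n, n') :: L) (n, n')) => //=; first exact: mem_head.
  by move=> ?; apply: nr.
move=> s; rewrite inE => /predU1P[-> /= /same_sym/same_irr//|sL].
have [ps|qs] := side _ (map_f fst sL).
  by apply: between_trans ps => /same_sym.
by apply: between_trans qs => /same_sym.
Qed.

(** Stage [n] puts [e n], if its order is admissible, into the domain and, after flipping, into the
    range; [rho] is the union of the stages. *)
Lemma back_and_forth (e : nat -> T) L0 p0 :
  (forall r, P (ord r) -> exists k, e k = r) -> good L0 -> p0 \in L0 ->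
  exists rho : T -> T -> Prop,
    [/\ forall p, p \in L0 -> rho p.1 p.2,
        forall r, P (ord r) -> exists r', rho r r',
        forall r', P (ord r') -> exists r, rho r r' &
        forall a a' b b' c c', rho a a' -> rho b b' -> rho c c' ->
          same a b c <-> same a' b' c'].
Proof.
move=> eP gL0 p0L.
have /choice[g gP] : forall nL : nat * seq (T * T), exists L', good nL.2 ->
  p0 \in nL.2 ->
    [/\ good L', {subset nL.2 <= L'} & P (ord (e nL.1)) ->
      (exists r', (e nL.1, r') \in L') /\ (exists r, (r, e nL.1) \in L')].
  move=> [n L]; have [[gL pL]|] := pselect (good L /\ p0 \in L); last first.
    by move=> H; exists L => gL pL; case: H.
  have [Pn|nP] := pselect (P (ord (e n))); last first.
    by exists L => _ _; split=> // /nP.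
  have [L1 [gL1 LL1 [r' rL1]]] := good_extend gL pL Pn.
  have fL1 : (p0.2, p0.1) \in [seq (p.2, p.1) | p <- L1].
    by apply/mapP; exists p0 => //; exact: LL1.
  have [L2 [gL2 LL2 [r rL2]]] := good_extend (good_flip gL1) fL1 Pn.
  have L12 p : p \in L1 -> p \in [seq (p.2, p.1) | p <- L2].
    move=> pL1; apply/mapP; exists (p.2, p.1); last exact: surjective_pairing.
    by apply: LL2; apply/mapP; exists p.
  exists [seq (p.2, p.1) | p <- L2] => _ _; split.
  - exact: good_flip.
  - by move=> p /LL1/L12.
  - move=> _; split; first by exists r'; exact: L12.
    by exists r; apply/mapP; exists (e n, r).
pose L := fix L (n : nat) := if n is n'.+1 then g (n', L n') else L0.
have LP (n : nat) : good (L n) /\ p0 \in L n.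
  elim: n => //= n [gL pL]; have [? sub _] := gP (n, L n) gL pL.
  by split=> //; exact: sub.
have LS (n : nat) : {subset L n <= L n.+1}.
  by have [gL pL] := LP n; have [] := gP (n, L n) gL pL.
have Lmono (m n : nat) : (m <= n)%N -> {subset L m <= L n}.
  by move=> /subnK <-; elim: (n - m)%N => // k IH p /IH/LS.
exists (fun x y => exists n : nat, (x, y) \in L n); split.
- by move=> [x y] xy; exists 0%N.
- move=> r Pr; have [n nr] := eP _ Pr; have [gL pL] := LP n.
  have [_ _] := gP (n, L n) gL pL; rewrite /= nr => /(_ Pr)[[r' rr'] _].
  by exists r', n.+1.
- move=> r Pr; have [n nr] := eP _ Pr; have [gL pL] := LP n.
  have [_ _] := gP (n, L n) gL pL; rewrite /= nr => /(_ Pr)[_ [r' rr']].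
  by exists r', n.+1.
- move=> a a' b b' c c' [i ai] [j bj] [k ck].
  have [[iL _ _] _] := LP (maxn i (maxn j k)).
  apply: (iL (a, a') (b, b') (c, c')).
  + by apply: Lmono ai; rewrite leq_maxl.
  + by apply: Lmono bj; rewrite (leq_trans (leq_maxl j k))// leq_maxr.
  + by apply: Lmono ck; rewrite (leq_trans (leq_maxr j k))// leq_maxr.
Qed.

End partial_isomorphisms.

End pretree.

(** * Sides of points in dendrites *)

Definition same (X : topologicalType) (c a b : X) : Prop :=
  connected_component (~` [set c]) a b.

Section same_side.
Variable X : topologicalType.
Implicit Types (a b c d m r x y z : X) (K : set X).

Lemma same_sym c a b : same c a b -> same c b a.
Proof. exact: connected_component_sym. Qed.

Lemma same_trans c b a d : same c a b -> same c b d -> same c a d.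
Proof. exact: connected_component_trans. Qed.

Lemma same_irr c b : ~ same c c b.
Proof. by rewrite /same connected_component_out//=; apply. Qed.

Lemma same_refl c a : a <> c -> same c a a.
Proof. by move=> ac; apply: connected_component_refl. Qed.

Lemma same_connected K c a b : connected K -> K a -> K b -> ~ K c -> same c a b.
Proof.
by move=> cK Ka Kb Kc; exists K => //; split=> // x Kx xc; apply: Kc;
  rewrite -xc.
Qed.

Lemma same_component c a b : a <> c ->
  same c a b <-> connected_component (~` [set c]) a = connected_component (~`
    [set c]) b.
Proof.
move=> ac; split; first exact: same_connected_component.
move=> E; apply: same_sym; rewrite /same -E; exact: connected_component_refl.
Qed.

Hypotheses (hX : hausdorff_space X) (lX : locally_connected X).

Lemma open_set1C c : open (~` [set c]).
Proof.
by apply: closed_openC; apply: accessible_closed_set1;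
  exact: hausdorff_accessible.
Qed.

Lemma component_open K x : open K -> open (connected_component K x).
Proof.
move=> oK; rewrite openE => y Ky.
have [|V [oV Vy cV VK]] := lX (x := y) (U := K).
  by apply: open_nbhs_nbhs; split=> //; exact: connected_component_sub Ky.
rewrite (same_connected_component Ky).
apply: filterS (open_nbhs_nbhs (conj oV Vy)).
exact: connected_component_max.
Qed.

Lemma same_open c a : open [set b | same c a b].
Proof. by apply: component_open; exact: open_set1C. Qed.

Hypothesis cX : connected [set: X].

(** The closure of the component adds at most [c]; without [c] the component would be open and
    closed. *)
Lemma component_adherent c z : z <> c -> closure [set b | same c z b] c.
Proof.
move=> zc; apply: contrapT => ncl.
set K := [set b | same c z b] in ncl *.
have KT : K = setT.
  apply: cX.
  - by exists z; exact: same_refl.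
  - by exists K; [exact: same_open|rewrite setTI].
  - exists (closure K); first exact: closed_closure.
    rewrite setTI eqEsubset; split; first exact: subset_closure.
    move=> y clKy; have [yc|yc] := pselect (y = c); first by rewrite yc in clKy.
    have [w [Kw yw]] := clKy _ (open_nbhs_nbhs (conj (same_open c y)
      (same_refl yc))).
    by apply: same_trans Kw _; exact: same_sym.
have : K c by rewrite KT.
by move=> /same_sym/same_irr.
Qed.

(** The closure of the side of [c] containing [z] is connected, contains [c] and [z], and avoids
    [d]. *)
Lemma same_cross c d z : c <> d -> ~ same c d z -> same d c z.
Proof.
move=> cd ndz; have [->|zc] := pselect (z = c); first exact: same_refl.
apply: (@same_connected (closure [set b | same c z b])).
- by apply: connected_closure; exact: component_connected.
- exact: component_adherent.
- by apply: subset_closure; exact: same_refl.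
- have dc : d <> c by move=> dc; apply: cd.
  move=> /(_ _ (open_nbhs_nbhs (conj (same_open c d) (same_refl dc)))) [w [zw
    dw]].
  by apply: ndz; apply: same_trans dw _; exact: same_sym.
Qed.

End same_side.

Section dendrite.
Variables (R : realType) (X : topologicalType).
Hypothesis dX : dendrite R X.
Implicit Types (a b c d m r x y z : X) (A : set X).

Let kX : compact [set: X]. Proof. by case: dX. Qed.
Let cX : connected [set: X]. Proof. by case: dX. Qed.
Let lX : locally_connected X. Proof. by case: dX. Qed.
Let mX : metrizable R X. Proof. by case: dX. Qed.
Let hX : hausdorff_space X. Proof. exact: metrizable_hausdorff mX. Qed.

Lemma arc_compact_connected a b A : arc R a b A ->
  [/\ compact A, connected A, A a & A b].
Proof.
move=> [f [g [cf _ fA _ [f0 f1]]]]; rewrite -fA; split.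
- by apply: continuous_compact => //; exact: segment_compact.
- by apply: connected_continuous_connected => //; exact: segment_connected.
- by exists 0 => //=; rewrite in_itv /= lexx ler01.
- by exists 1 => //=; rewrite in_itv /= lexx ler01.
Qed.

(** An arc missing [c] is a connected set joining [a] to [b] off [c]. If [c] does not separate them,
    their component is open and contains an arc avoiding [c], which by uniqueness is [A]. *)
Lemma arcP a b A c : arc R a b A -> A c <-> ~ same c a b.
Proof.
move=> aA; have [_ cA Aa Ab] := arc_compact_connected aA.
split=> [Ac cab|ncab]; last first.
  by apply: contrapT => nAc; apply: ncab; exact: same_connected cA _ _ _.
have ab : a <> b.
  move: aA => [f [g [_ _ _ fK [f0 f1]]]] E; have := oner_neq0 R;
    apply/negP/negPn.
  rewrite -(fK 1) ?in_itv /= ?lexx ?ler01// f1 -E -f0 fK//.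
  by rewrite in_itv /= lexx ler01.
have [B BC aB] := open_connected_arcX kX lX mX
  (component_open lX a (@open_set1C X hX c)) (@component_connected X (~` [set
    c]) a)
  (connected_component_refl (same_neq (@same_irr X) cab)) cab ab.
have [_ _ _ _ /(_ a b ab)[E [_ uE]]] := dX.
have AB : A = B by rewrite -(uE A aA) (uE B aB).
have Bc : B c by rewrite -AB.
by have := @connected_component_sub _ _ _ _ (BC c Bc); exact.
Qed.

Lemma arc_ex a b : a <> b -> exists A, arc R a b A.
Proof. by move=> ab; have [_ _ _ _ /(_ a b ab)[E [aE _]]] := dX; exists E. Qed.

Let Strans := @same_trans X.

Lemma between_refl a c : ~ same c a a <-> c = a.
Proof.
split=> [nc|->]; last exact: same_irr.
by apply: contrapT => ca; apply: nc; apply: same_refl => ac; apply: ca.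
Qed.

Lemma between_closed a b : closed [set c | ~ same c a b].
Proof.
have [->|/arc_ex[A aA]] := pselect (a = b).
  rewrite (_ : [set _ | _] = [set b]); last first.
    by apply/seteqP; split=> c /=; rewrite between_refl.
  by apply: accessible_closed_set1; exact: hausdorff_accessible.
rewrite (_ : [set _ | _] = A); last first.
  by apply/seteqP; split=> c /=; rewrite (arcP _ aA).
by apply: compact_closed => //; have [] := arc_compact_connected aA.
Qed.

Lemma between_connected a b : a <> b -> connected [set c | ~ same c a b].
Proof.
move=> /arc_ex[A aA]; rewrite (_ : [set _ | _] = A); last first.
  by apply/seteqP; split=> c /=; rewrite (arcP _ aA).
by have [] := arc_compact_connected aA.
Qed.

(** With no median, the closed segments from [a] to [c] and from [b] to [c] would split the segment
    from [a] to [b]. Being connected, it lies in the first, which makes [b] a median. *)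
Lemma med_exists a b c : exists m, med (@same X) m a b c.
Proof.
have sirr c' d : ~ same c' d c' by move=> /same_sym/same_irr.
have [->|ab] := pselect (a = b).
  by exists b; split; exact: same_irr.
apply: contrapT => nm.
have : [set d | ~ same d a b /\ ~ same d a c] = [set d | ~ same d a b].
  apply: between_connected => //.
  - by exists a; split; exact: same_irr.
  - exists (~` [set d | ~ same d b c]).
      by apply: closed_openC; exact: between_closed.
    apply/seteqP; split=> d /= [dab H]; split=> //.
      by move=> dbc; apply: nm; exists d.
    have [//|dcb] := between_tri Strans c dab.
    by case: H => /same_sym.
  - by exists [set d | ~ same d a c]; first exact: between_closed.
move=> /seteqP[_ /(_ b)[|_ bac]]; first exact: sirr.
by apply: nm; exists b; split; [exact: sirr|exact: same_irr|].
Qed.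

End dendrite.

Lemma distinct3 (T : choiceType) (E : {fset T}) : (3 <= #|` E|)%N ->
  exists x y z, [/\ x \in E, y \in E, z \in E & [/\ x <> y, y <> z & x <> z]].
Proof.
rewrite cardfE => E3.
have mem x : x \in (E : seq T) -> x \in E by [].
move: E3 (fset_uniq E) mem; rewrite -cardfE.
case: (E : seq T) => [|x [|y [|z s]]] //= _ /and4P[xs ys _ _] mem.
exists x, y, z; split; try by apply: mem; rewrite !inE eqxx ?orbT.
by move: xs ys; rewrite !inE !negb_or =>
  /and3P[/eqP ? /eqP ? _] /andP[/eqP ? _].
Qed.

(** * Ramification points, medians and orders *)

Section orders.
Variable X : topologicalType.
Implicit Types (a b c d m r x y z : X).

Let Ssym := @same_sym X.
Let Sirr := @same_irr X.
Let Srefl := @same_refl X.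

Lemma components_same c a b : a <> c ->
  connected_component (~` [set c]) a = connected_component (~` [set c]) b ->
    same c a b.
Proof. by move=> ac; apply (same_component b ac). Qed.

Lemma ramification_med m : ramification_point m ->
  exists a b c, med (@same X) m a b c /\ [/\ a <> m, b <> m & c <> m].
Proof.
move=> rm.
have [E [Esub E3]] : exists E : {fset (set X)},
    (forall K, K \in E -> components (~` [set m]) K) /\ (3 <= #|` E|)%N.
  move: rm; rewrite /ramification_point /point_order.
  case: asboolP => [fC /= C3|iC _].
    by exists (fset_set (components (~` [set m]))); split=> // K;
      rewrite in_fset_set// inE.
  have [E EC E3] := infinite_set_fset 3 iC.
  by exists E; split=> // K KE; apply: EC.
have [K1 [K2 [K3 [K1E K2E K3E [K12 K23 K13]]]]] := distinct3 E3.
have [a am Ka] := Esub _ K1E; have [b bm Kb] := Esub _ K2E.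
have [c cm Kc] := Esub _ K3E.
exists a, b, c; split=> //; split=> /same_connected_component E'.
- by apply: K12; rewrite -Ka -Kb.
- by apply: K23; rewrite -Kb -Kc.
- by apply: K13; rewrite -Ka -Kc.
Qed.

Lemma med_ramification m a b c : med (@same X) m a b c ->
  a <> m -> b <> m -> c <> m -> ramification_point m.
Proof.
move=> [ab bc ac] am bm cm; rewrite /ramification_point /point_order.
case: asboolP => // fC /=.
pose K x := connected_component (~` [set m]) x.
have CK x : x <> m -> K x \in fset_set (components (~` [set m])).
  by move=> xm; rewrite in_fset_set// inE; exists x.
have KK x y : x <> m -> ~ same m x y -> K x != K y.
  by move=> xm nxy; apply/eqP => /(components_same xm).
have <- : #|` [fset x in [:: K a; K b; K c]]%fset| = 3%N.
  rewrite card_fseq undup_id//= !inE negb_or.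
  by rewrite (KK a b)// (KK a c)// (KK b c).
by apply: fsubset_leq_card; apply/fsubsetP => z;
  rewrite !inE => /orP[|/orP[|/orP[|//]]] /eqP ->; exact: CK.
Qed.

(* Otherwise every side of [m'] meets [L], which injects the sides of [m'] into
   the sides of [m] other than that of [r], although there are equally many. *)
Lemma new_branch (L : seq (X * X)) m m' r :
  iso (@same X) L -> (m, m') \in L -> point_order m = point_order m' ->
  r <> m -> {in L, forall p, ~ same m r p.1} ->
  exists2 z, z <> m' & {in L, forall p, ~ same m' z p.2}.
Proof.
move=> iL mL omm' rm Lr; apply: contrapT => nz.
have hit z : z <> m' -> exists2 p, p \in L & same m' z p.2.
  move=> zm'; apply: contrapT => np; apply: nz; exists z => // p pL zp.
  by apply: np; exists p.
pose C := components (~` [set m]); pose C' := components (~` [set m']).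
have fC' : finite_set C'.
  apply: (@sub_finite_set _ _ ((fun p =>
    connected_component (~` [set m']) p.2) @` [set` L])).
    move=> _ [z zm' <-]; have [p pL zp] := hit z zm'.
    by exists p => //; apply/esym/same_connected_component.
  by apply: finite_image; exact: finite_seq.
move: omm'; rewrite /point_order -/C -/C'.
case: (asboolP (finite_set C)) => fC;
  case: (asboolP (finite_set C')) => // _ [cC].
have /choice[phi phiP] : forall K : set X, exists K2 : set X, C' K ->
    [/\ C K2, K2 <> connected_component (~` [set m]) r & exists p,
      [/\ p \in L, p.1 <> m, K = connected_component (~` [set m']) p.2 &
        K2 = connected_component (~` [set m]) p.1]].
  move=> K; have [C'K|] := pselect (C' K); last by exists set0.
  move: (C'K) => [z zm' Kz]; have [p pL zp] := hit z zm'.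
  have pm' := same_neqr Ssym Sirr zp.
  have pm : p.1 <> m by move=> /(iso_eq Sirr Srefl iL pL mL).
  exists (connected_component (~` [set m]) p.1) => _; split;
    first by exists p.1.
    by move=> /esym/(components_same rm); exact: Lr.
  by exists p; split=> //; rewrite -Kz; exact: same_connected_component.
have phi_inj : {in fset_set C' &, injective phi}.
  move=> K1 K2; rewrite !in_fset_set// !inE => C1 C2 E.
  have [_ _ [p [pL pm Kp Pp]]] := phiP _ C1.
  have [_ _ [q [qL qm Kq Pq]]] := phiP _ C2.
  rewrite Kp Kq; apply: same_connected_component.
  apply/(iL (m, m') p q) => //=; apply: components_same => //.
  by rewrite -Pp -Pq.
have : (#|` phi @` fset_set C'| <= #|` fset_set C `\ connected_component (~`
  [set m]) r|)%fset%N.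
  apply: fsubset_leq_card; apply/fsubsetP => _ /imfsetP[K /= KC ->].
  have {}KC : C' K by move: KC; rewrite in_fset_set// => /set_mem.
  have [CK Kr _] := phiP _ KC.
  by rewrite in_fsetD1 in_fset_set// (mem_set CK) andbT; apply/eqP.
rewrite card_in_imfset//= -cC.
have rC : connected_component (~` [set m]) r \in fset_set C.
  by rewrite in_fset_set// inE; exists r.
by rewrite [in X in (X <= _)%N](cardfsD1 (connected_component (~` [set m]) r))
  rC add1n ltnn.
Qed.

End orders.

(** * Baire category in compact spaces and pointwise convergence *)

Lemma setT_compactX (X Y : topologicalType) :
  compact [set: X] -> compact [set: Y] -> compact [set: X * Y].
Proof. by move=> cX cY; rewrite -setXTT; exact: compact_setX. Qed.

(** Open sets are shrunk so that each closure avoids the next member of [F]; a cluster point of the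
    sequence avoids them all. *)
Lemma compact_baire (X : topologicalType) (F : set (set X)) :
  hausdorff_space X -> compact [set: X] -> [set: X] !=set0 -> countable F ->
  (forall K, F K -> closed K) ->
  (forall K U, F K -> open U -> U !=set0 -> exists2 x, U x & ~ K x) ->
  exists x, forall K, F K -> ~ K x.
Proof.
move=> hX cX X0 /countable_injP[f f_inj] Fc Fd.
pose N k := xget set0 [set K | F K /\ f K = k].
have NP k : closed (N k) /\ forall U, open U -> U !=set0 ->
  exists2 x, U x & ~ N k x.
  rewrite /N; case: xgetP => [K _ [FK _]|_]; first by split;
    [exact: Fc|move=> U; exact: Fd].
  by split; [exact: closed0|move=> U _ [x Ux]; exists x].
have /choice[g gP] : forall kV : nat * set X, exists V : set X,
    open kV.2 -> kV.2 !=set0 ->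
    [/\ open V, V !=set0 & closure V `<=` kV.2 `\` N kV.1].
  move=> [k V]; have [[oV V0]|nV] := pselect (open V /\ V !=set0); last first.
    by exists V => oV V0; case: nV.
  have [cN dN] := NP k; have [x Vx Nx] := dN V oV V0.
  have : nbhs x (V `\` N k).
    by apply: open_nbhs_nbhs; split=> //; apply: openI => //;
      exact: closed_openC.
  move/(compact_regular hX cX (filterT : nbhs x setT)) => [C nC CV].
  exists C° => _ _; split; first exact: open_interior.
    by exists x.
  by apply: subset_trans CV; apply: closure_subset; exact: interior_subset.
pose V := fix V (k : nat) := if k is k'.+1 then g (k', V k') else setT.
have VP k : open (V k) /\ V k !=set0.
  elim: k => [|k [oV V0]]; first by split=> //; exact: openT.
  by have [] := gP (k, V k) oV V0.
have VS k : closure (V k.+1) `<=` V k `\` N k.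
  by have [oV V0] := VP k; have [] := gP (k, V k) oV V0.
have Vmono j k : (j <= k)%N -> V k `<=` V j.
  move=> /subnK <-; elim: (k - j)%N => // i IH; apply: subset_trans IH => x Vx.
  by have [] := VS _ _ (subset_closure Vx).
have FV : ProperFilter (filter_from setT V).
  apply: filter_from_proper; last by move=> k _; have [] := VP k.
  apply: filter_from_filter; first by exists 0%N.
  move=> i j _ _; exists (maxn i j) => // x Vx; split.
    by apply: Vmono Vx; rewrite leq_maxl.
  by apply: Vmono Vx; rewrite leq_maxr.
have [x [_ clx]] := cX _ FV filterT.
exists x => K FK Kx.
have : closure (V (f K).+1) x.
  by move=> B nB; apply: clx => //; exists (f K).+1.
move=> /VS[_]; apply; rewrite /N; case: xgetP => [K' _ [FK' fK']|/(_ K) []//].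
by rewrite (f_inj K' K) ?inE.
Qed.

Definition endpoint (X : topologicalType) (x : X) :=
  forall a b, a <> x -> b <> x -> same x a b.

Definition collapsed (X : topologicalType) (x e : X) : {ptws X -> X} :=
  fun z => if z == x then x else e.

Lemma pointwise_cvg (X Y : topologicalType) (F : set_system {ptws X -> Y})
    (f : {ptws X -> Y}) : Filter F ->
  (forall x U, nbhs (f x) U -> F [set h | U (h x)]) -> F --> f.
Proof.
move=> FF Ff; apply/cvg_sup => x U [V] [[W] oW <-] Wfx WU.
by apply: (filterS WU); apply: Ff; exact: open_nbhs_nbhs.
Qed.

Lemma evaluation_nbhs (X Y : topologicalType) (f : {ptws X -> Y}) x U :
  nbhs (f x) U -> nbhs f [set h : {ptws X -> Y} | U (h x)].
Proof. exact: (@proj_continuous X (fun=> Y) x f). Qed.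

(** * Homogeneity and endpoints of Wazewski dendrites *)

Section wazewski.
Variables (R : realType) (P : set (option nat)) (X : topologicalType).
Hypotheses (P_orders : P `<=` ramification_orders) (P0 : P !=set0).
Hypothesis wX : wazewski_dendrite R P X.
Implicit Types (a b c d m r x y z : X) (A : set X).

Let dX : dendrite R X. Proof. by case: wX. Qed.
Let kX : compact [set: X]. Proof. by case: dX. Qed.
Let cX : connected [set: X]. Proof. by case: dX. Qed.
Let lX : locally_connected X. Proof. by case: dX. Qed.
Let mX : metrizable R X. Proof. by case: dX. Qed.
Let hX : hausdorff_space X. Proof. exact: metrizable_hausdorff mX. Qed.

Let Ssym := @same_sym X.
Let Strans := @same_trans X.
Let Sirr := @same_irr X.
Let Srefl := @same_refl X.
Let Scross := same_cross hX lX cX.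

(** Density is applied between the points at one third and two thirds of an arc from [a] to [b], so
    that the point found is neither end. *)
Lemma edge_realized a b p : a <> b -> P p ->
  exists r, [/\ p = point_order r, r <> a, r <> b & ~ same r a b].
Proof.
move=> ab Pp; have [A aA] := arc_ex dX ab.
have [f [g [_ _ fA fK [f0 f1]]]] := aA.
have inA t : 0 <= t <= 1 -> A (f t).
  by move=> t01; rewrite -fA; exists t => //=; rewrite in_itv.
have f_inj s t : 0 <= s <= 1 -> 0 <= t <= 1 -> f s = f t -> s = t.
  by move=> s01 t01 E; rewrite -(fK s) ?in_itv// E fK ?in_itv.
pose a' := f 3^-1; pose b' := f (2 / 3).
have Aa' : A a' by apply: inA; lra.
have Ab' : A b' by apply: inA; lra.
have a'b' : a' <> b' by move=> /f_inj; lra.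
have a'a : a' <> a by rewrite -f0 => /f_inj; lra.
have a'b : a' <> b by rewrite -f1 => /f_inj; lra.
have b'a : b' <> a by rewrite -f0 => /f_inj; lra.
have b'b : b' <> b by rewrite -f1 => /f_inj; lra.
have na' := (arcP dX a' aA).1 Aa'; have nb' := (arcP dX b' aA).1 Ab'.
have [A' aA'] := arc_ex dX a'b'.
have [_ _ /(_ p Pp) dP _] := wX.
have [r [[_ rp] /(arcP dX r aA') rab']] := dP _ _ _ aA'.
have nsym c d e : ~ same c d e -> ~ same c e d by move=> + /same_sym.
exists r; split=> //.
- move=> ra; apply: rab'; rewrite ra.
  have aa' : same a a' b by apply: Scross.
  have ab'' : same a b' b by apply: Scross.
  by apply: same_trans aa' _; exact: same_sym.
- move=> rb; apply: rab'; rewrite rb.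
  have aa' : same b a' a by apply: Scross => //; exact: nsym.
  have ab'' : same b b' a by apply: Scross => //; exact: nsym.
  by apply: same_trans aa' _; exact: same_sym.
- have [ra'|rb'] := between_tri Strans a rab'.
    by apply: (between_trans Ssym Strans Scross) (nsym _ _ _ ra') _.
  by apply: (between_trans Ssym Strans Scross) rb' _.
Qed.

Lemma med_order m a b c : med (@same X) m a b c ->
  m <> a -> m <> b -> m <> c -> P (point_order m).
Proof.
move=> mm ma mb mc; have [_ _ _] := wX; apply.
by apply: med_ramification mm _ _ _ => E; [apply: ma|apply: mb|apply: mc].
Qed.

Lemma leaf_realized (L : seq (X * X)) (m : X * X) r :
  good (@same X) (@point_order X) L -> m \in L -> P (point_order r) ->
  r <> m.1 -> {in L, forall p, ~ same m.1 r p.1} ->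
  exists r', [/\ point_order r = point_order r', r' <> m.2 &
    {in L, forall p, ~ same m.2 r' p.2}].
Proof.
move=> [iL oL _] mL Pr rm Lr; move: (mL); rewrite [m]surjective_pairing => mL'.
have [z zm Lz] := new_branch iL mL' (oL _ mL) rm Lr.
have mz : m.2 <> z by move=> E; apply: zm.
have [r' [rr' rm' rz rmz]] := edge_realized mz Pr.
exists r'; split=> // p pL rp; apply: (Lz p pL).
apply: same_trans rp; apply: same_sym.
by apply: Scross.
Qed.

(** A connected open neighbourhood of [z] is not a single point, since that would be open and
    closed; it contains the segment between two of its points, and on it a point of order in [P]. *)
Lemma order_dense (U : set X) : open U -> U !=set0 ->
  exists2 r, U r & P (point_order r).
Proof.
move=> oU [z Uz].
have [V [oV Vz cV VU]] := lX (open_nbhs_nbhs (conj oU Uz)).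
have [y [Vy yz]] : exists y, V y /\ z <> y.
  apply: contrapT => nV.
  have Vz' : V = [set z].
    apply/seteqP; split=> y; last by move=> ->.
    by move=> Vy; apply: contrapT => yz; apply: nV; exists y; split=> // zy;
      apply: yz.
  have VT : V = setT.
    apply: cX; [by exists z|by exists V => //; rewrite setTI|].
    exists V; last by rewrite setTI.
    by rewrite Vz'; apply: accessible_closed_set1; exact: hausdorff_accessible.
  have [_ [x [y xy]] _ _] := wX; apply: xy.
  have : V x /\ V y by rewrite VT.
  by rewrite Vz' => -[-> ->].
have [p Pp] := P0.
have [r [rp rz ry rzy]] := edge_realized yz Pp.
exists r; last by rewrite -rp.
by apply: VU; apply: contrapT => Vr; apply: rzy; exact: same_connected cV _ _ _.
Qed.

(** Points with order in [P] are ramification points. Each is the median of three points of a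
    countable dense set, one from each of three open sides, and medians are unique. *)
Lemma order_enumeration (x0 : X) : exists e : nat -> X,
  forall r, P (point_order r) -> exists k, e k = r.
Proof.
have [D cD dD] := compact_metrizable_separable kX mX.
pose S : set X := [set r : X | P (point_order r)].
have cS : countable S.
  pose g (t : X * X * X) := xget x0 [set m | med (@same X) m t.1.1 t.1.2 t.2].
  have cDDD : countable (g @` (D `*` D `*` D)).
    by apply: sub_countable (card_image_le _ _) _;
      do 2! apply: countableX => //.
  apply: sub_countable cDDD; apply: subset_card_le => m /P_orders rm.
  have [a [b [c [[ab bc ac] [am bm cm]]]]] := ramification_med rm.
  have near z : z <> m -> exists2 d, D d & same m z d.
    move=> zm; have [|d [/= zd Dd]] := dD _ _ (same_open hX lX m z).
      by exists z; exact: same_refl.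
    by exists d.
  have [a' Da aa'] := near _ am; have [b' Db bb'] := near _ bm.
  have [c' Dc cc'] := near _ cm.
  have mm : med (@same X) m a' b' c'.
    have move2 u u' v v' : same m u u' -> same m v v' -> ~ same m u v ->
      ~ same m u' v'.
      move=> uu' vv' uv u'v'; apply: uv.
      exact: same_trans (same_trans uu' u'v') (same_sym vv').
    by split; [exact: move2 ab|exact: move2 bc|exact: move2 ac].
  have gm : med (@same X) (g (a', b', c')) a' b' c'.
    by apply: (@xgetPex _ x0 [set m | med (@same X) m a' b' c']); exists m.
  exists (a', b', c') => //=.
  exact: (med_unique Ssym Strans Scross gm mm).
have /countable_injP[f f_inj] := cS.
exists (fun k => xget x0 [set r | S r /\ f r = k]) => r Pr; exists (f r).
have [Sr fr] : S (xget x0 [set r' | S r' /\ f r' = f r]) /\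
    f (xget x0 [set r' | S r' /\ f r' = f r]) = f r.
  by apply: (@xgetPex _ x0 [set r' | S r' /\ f r' = f r]); exists r.
by apply: f_inj => //; rewrite inE.
Qed.

(** * From side-preserving relations to homeomorphisms *)

Definition same_preserving (rho : X -> X -> Prop) :=
  [/\ forall r, P (point_order r) -> exists r', rho r r',
      forall r', P (point_order r') -> exists r, rho r r' &
      forall a a' b b' c c', rho a a' -> rho b b' -> rho c c' ->
        same a b c <-> same a' b' c'].

Definition relation_graph (rho : X -> X -> Prop) : set (X * X) :=
  closure [set p | rho p.1 p.2].

(** The first projection of the graph is closed and contains the dense set of points of order in
    [P]. *)
Lemma relation_graph_total rho z : same_preserving rho ->
  exists z', relation_graph rho (z, z').
Proof.
move=> [dom _ _].
have cG : compact (relation_graph rho).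
  apply: subclosed_compact (setT_compactX kX kX) _ => //; exact: closed_closure.
have cfG : closed (fst @` relation_graph rho).
  apply: compact_closed => //; apply: continuous_compact => //.
  by apply: continuous_subspaceT => p; exact: cvg_fst.
apply: contrapT => nz.
have [||r nr /dom[r' rr']] := order_dense (U := ~` (fst @` relation_graph rho)).
- exact: closed_openC.
- by exists z => -[[z1 z2] /= zz E]; apply: nz; exists z2; rewrite -E.
by apply: nr; exists (r, r') => //; exact: subset_closure.
Qed.

(* Pull back two points separating [z1] from [z2]: each would separate [z] from
   the other one. *)
Lemma relation_graph_functional rho z z1 z2 : same_preserving rho ->
  relation_graph rho (z, z1) -> relation_graph rho (z, z2) -> z1 = z2.
Proof.
move=> [_ cod iso] zz1 zz2; apply: contrapT => z12.
have [p Pp] := P0.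
have [r1 [p1 r1z1 r1z2 r1z]] := edge_realized z12 Pp.
have [r2 [p2 r21 r2z2 r2z]] := edge_realized r1z2 Pp.
have [s1 s1r1] : exists s, rho s r1 by apply: cod; rewrite -p1.
have [s2 s2r2] : exists s, rho s r2 by apply: cod; rewrite -p2.
have nsym c d e : ~ same c d e -> ~ same c e d by move=> + /same_sym.
have z1r1 : z1 <> r1 by move=> E; apply: r1z1.
have z2r2 : z2 <> r2 by move=> E; apply: r2z2.
have s12 : s1 <> s2.
  move=> E; have := iso _ _ _ _ _ _ s1r1 s2r2 s2r2; rewrite E => -[_].
  by move=> /(_ (same_refl r21))/same_irr.
have r1r2 : same r1 r2 z2 by apply: Scross.
(* If [r'] separates [w] from the limit value [w'], then [s] separates [t] from [z]: otherwise a
   related pair close to [(z, w')] would violate the preservation of sides. *)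
have push s t r' w w' : rho s r' -> rho t w -> w' <> r' -> ~ same r' w' w ->
    relation_graph rho (z, w') -> ~ same s t z.
  move=> sr tw wr nw zw stz.
  have nzw : nbhs (z, w') ([set a | same s t a] `*` [set a | same r' w' a]).
    exists ([set a | same s t a], [set a | same r' w' a]) => //; split.
      by apply: open_nbhs_nbhs; split=> //; exact: same_open.
    by apply: open_nbhs_nbhs; split; [exact: same_open|exact: same_refl].
  have [[a a'] /= [aa' [sa ra']]] := zw _ nzw.
  apply: nw; apply: same_trans ra' _; apply: same_sym.
  exact: (iso _ _ _ _ _ _ sr tw aa').1.
have n1 : ~ same s1 s2 z.
  apply: (push _ _ r1 r2 z1) => //.
  by move=> z1r2; apply: r1z; apply: same_trans z1r2 r1r2.
have n2 : ~ same s2 s1 z.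
  apply: (push _ _ r2 r1 z2) => //.
  exact: nsym.
by apply: n1; apply: Scross n2 => E; apply: s12.
Qed.

Lemma relation_graph_fun rho : same_preserving rho -> exists g : X -> X,
  [/\ continuous g, forall z, relation_graph rho (z, g z) &
      forall z z', relation_graph rho (z, z') -> z' = g z].
Proof.
move=> srho.
have /choice[g gG] : forall z, exists z', relation_graph rho (z, z').
  by move=> z; exact: relation_graph_total.
have gU z z' : relation_graph rho (z, z') -> z' = g z.
  by move=> zz'; exact: relation_graph_functional srho zz' (gG z).
exists g; split=> //; apply/continuous_subspace_setT.
apply: (compact_graph_continuous (K := relation_graph rho)) => //.
- by apply: subclosed_compact (setT_compactX kX kX) _ => //;
    exact: closed_closure.
- by move=> z z' _; exact: gU.
Qed.

Lemma relation_graph_flip rho z z' : relation_graph rho (z, z') ->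
  relation_graph (fun a b => rho b a) (z', z).
Proof.
move=> zz' V [[V1 V2] /= [nV1 nV2] V12].
have [[a b] /= [ab [V2a V1b]]] : [set p | rho p.1 p.2] `&` (V2 `*` V1) !=set0.
  by apply: zz'; exists (V2, V1).
by exists (b, a); split=> //; apply: V12.
Qed.

(** The flipped relation gives the inverse, because the closures of the two graphs are transposes of
    each other. *)
Lemma relation_homeo rho : same_preserving rho ->
  exists g : homeo X, forall a a', rho a a' -> homeo_fun g a = a'.
Proof.
move=> srho.
have srho' : same_preserving (fun a b => rho b a).
  move: srho => [dom cod iso]; split=> //.
  by move=> a a' b b' c c' aa bb cc; apply: iff_sym; exact: iso.
have [g [cg gG gU]] := relation_graph_fun srho.
have [h [ch hG hU]] := relation_graph_fun srho'.
have gP : homeo_set X g.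
  split=> //; exists h; split=> // z; apply/esym.
    by apply: hU; exact: relation_graph_flip.
  by apply: gU; exact: (relation_graph_flip (hG z)).
exists (SigSub (mem_set gP)) => // a a' aa'.
by apply/esym/gU; exact: subset_closure.
Qed.

Lemma homogeneous x r r' : x <> r -> x <> r' -> P (point_order r) ->
  point_order r = point_order r' ->
  exists g : homeo X, homeo_fun g x = x /\ homeo_fun g r = r'.
Proof.
move=> xr xr' Pr rr'.
have [e eP] := order_enumeration x.
pose L0 := [:: (x, x); (r, r')].
have gL0 : good (@same X) (@point_order X) L0.
  have sameT a b : b <> a -> same a b b <-> True by move=> ba; split=> // _;
    exact: same_refl.
  have sameF a b : same a a b <-> False by split=> // /same_irr.
  have sameF' a b : same a b a <-> False by split=> // /same_sym/same_irr.
  have rx : r <> x by move=> E; apply: xr.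
  have r'x : r' <> x by move=> E; apply: xr'.
  split.
  - move=> p q s; rewrite !inE => /orP[]/eqP-> /orP[]/eqP-> /orP[]/eqP-> /=;
      by rewrite ?sameF ?sameF' ?sameT.
  - by move=> p; rewrite !inE => /orP[]/eqP->.
  - have irr' c d : ~ same c d c by move=> /same_sym/same_irr.
    move=> a b c; rewrite !inE /= => aL bL cL.
    have [ab|ab] := eqVneq a b.
      by exists b; [rewrite !inE|rewrite ab; split; exact: same_irr].
    have [bc|bc] := eqVneq b c.
      by exists c; [rewrite !inE|rewrite bc; split => //; exact: same_irr].
    exists a; first by rewrite !inE.
    have ac : a = c.
      move: aL bL cL ab bc => /orP[]/eqP-> /orP[]/eqP-> /orP[]/eqP->;
      by rewrite ?eqxx.
    by rewrite -ac; split => //; exact: same_irr.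
have [rho [rho0 dom cod iso]] := back_and_forth Ssym Strans Sirr Srefl Scross
  leaf_realized edge_realized (med_exists dX) med_order eP gL0
  (mem_head _ _).
have [g gP] := relation_homeo (And3 dom cod iso).
exists g; split; apply: gP.
  by apply: (rho0 (x, x)); rewrite mem_head.
by apply: (rho0 (r, r')); rewrite !inE eqxx orbT.
Qed.

(** * Endpoints: existence and small neighbourhoods *)

(** A ramification point [r] in [U] has a side containing neither [d] nor [d']. Points [y] of that
    side see [r], [d] and [d'] in one direction, and they occur arbitrarily close to [r]. *)
Lemma between_nowhere_dense d d' U : open U -> U !=set0 ->
  exists2 y, U y & same y d d'.
Proof.
move=> oU U0; have [r Ur /P_orders rr] := order_dense oU U0.
have [a [b [c [[ab bc ac] [ar br cr]]]]] := ramification_med rr.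
have [z zr [zd zd']] : exists2 z, z <> r & ~ same r z d /\ ~ same r z d'.
  have two x y w : ~ same r x y -> ~ same r x w \/ ~ same r y w.
    move=> xy; have [xw|] := pselect (same r x w); last by left.
    by right=> yw; apply: xy; apply: same_trans xw (same_sym yw).
  have [ad|ad] := pselect (same r a d); last first.
    have [ad'|ad'] := pselect (same r a d'); last by exists a.
    have [bd'|//] := two a b d' ab; first by case: bd'.
    have [cd'|//] := two a c d' ac; first by case: cd'.
    have [bd|cd] := two b c d bc; [by exists b|by exists c].
  have [//|bd] := two a b d ab; have [//|cd] := two a c d ac.
  have [bd'|cd'] := two b c d' bc; [by exists b|by exists c].
have [y [zy Uy]] := component_adherent hX lX cX zr (open_nbhs_nbhs (conj oU
  Ur)).
exists y => //.
have ry : r <> y by move=> E; move: zy; rewrite E => /same_sym/same_irr.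
have yd w : ~ same r z w -> same y r w.
  move=> zw; apply: Scross => // yw; apply: zw; exact: same_trans zy yw.
by apply: same_trans (same_sym (yd _ zd)) (yd _ zd').
Qed.

(** Segments between points of a countable dense set [D], and single points of [C], are nowhere
    dense. A point off all of them is an endpoint: [D] meets each of its sides, and it separates no
    two points of [D]. *)
Lemma endpoint_notin (C : set X) : countable C -> exists2 x, endpoint x & ~ C x.
Proof.
move=> cC; have [D cD dD] := compact_metrizable_separable kX mX.
pose N (t : X * X) := [set c | ~ same c t.1 t.2].
have [||K [[t _ <-]|[c _ <-]]|K U [[t _ <-]|[c _ <-]] oU U0|x xN] :=
    @compact_baire X ((N @` (D `*` D)) `|` (set1 @` C)) hX kX.
- by have [_ [x _] _ _] := wX; exists x.
- rewrite -bigcup2inE; apply: bigcup_countable => // -[|[|[]]] //= _.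
    by apply: sub_countable (card_image_le _ _) _; apply: countableX.
  exact: sub_countable (card_image_le _ _) cC.
- exact: (between_closed dX).
- by apply: accessible_closed_set1; exact: hausdorff_accessible.
- by have [y Uy yd] := between_nowhere_dense t.1 t.2 oU U0;
    exists y => // /(_ yd).
- have [y Uy yc] := between_nowhere_dense c c oU U0.
  by exists y => // E; move: yc; rewrite E => /same_irr.
exists x; last by move=> Cx; apply: (xN [set x]) => //; right; exists x.
move=> a b ax bx.
have near z : z <> x -> exists2 d, D d & same x z d.
  move=> zx; have [|d [/= zd Dd]] := dD _ _ (same_open hX lX x z).
    by exists z; exact: same_refl.
  by exists d.
have [a' Da aa'] := near _ ax; have [b' Db bb'] := near _ bx.
have : same x a' b'.
  apply: contrapT => nx; apply: (xN (N (a', b'))) => //.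
  by left; exists (a', b').
by move=> a'b'; apply: same_trans (same_trans aa' a'b') (same_sym bb').
Qed.

(** The sides containing [x], taken at all points [r], form a filter base by medians; the medians
    differ from [x] because an endpoint separates nothing. Any other point is cut off from [x] by
    some [r], so by compactness these sides shrink to [x]. A point of order [p] is finally taken
    between [r] and [x]. *)
Lemma endpoint_small x p V : endpoint x -> P p -> nbhs x V ->
  exists r, [/\ x <> r, point_order r = p & [set y | same r x y] `<=` V].
Proof.
move=> ex Pp nV.
have toward a : a <> x -> exists r, [/\ x <> r, point_order r = p,
  a <> r & ~ same r a x].
  move=> ax; have [r [rp ra rx rax]] := edge_realized ax Pp.
  by exists r; split=> // E; [apply: rx|apply: ra].
have sub m t : ~ same m t x -> [set y | same m x y] `<=` [set y | same t x y].
  move=> mtx y /= mxy; have [<-//|mt] := pselect (m = t).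
  have mty : ~ same m t y by move=> mty; apply: mtx;
    apply: same_trans mty (same_sym mxy).
  by apply: same_trans (same_sym (Scross mt mtx)) (Scross mt mty).
pose G := filter_from [set r | x <> r] (fun r => [set y | same r x y]).
have GF : ProperFilter G.
  apply: filter_from_proper; last by move=> r xr; exists x; exact: same_refl.
  apply: filter_from_filter.
    have [_ [a [b ab]] _ _] := wX; have [ax|ax] := pselect (a = x).
      by exists b => /= E; apply: ab; rewrite ax.
    by exists a => /= E; apply: ax.
  move=> r s /= xr xs.
  have [m [mrs msx mrx]] := med_exists dX r s x.
  have xm : x <> m.
    by move=> E; apply: mrs; rewrite -E; apply: ex => ?; [apply: xr|apply: xs].
  exists m => //= y mxy; split; exact: sub mxy.
have Gx : G --> x.
  apply: (compact_cluster_set1 hX kX) => //; [exact: filterT|exact: filterT|].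
  apply/seteqP; split=> y.
    move=> cly; apply: contrapT => yx.
    have [r [xr _ ry ryx]] := toward _ yx.
    have [||z [/= xz yz]] := cly [set z | same r x z] [set z | same r y z].
    - by exists r.
    - by apply: open_nbhs_nbhs; split; [exact: same_open|exact: same_refl].
    - by apply: ryx; apply: same_trans yz (same_sym xz).
  by move=> -> A B [r /= xr rA] nB; exists x; split; [apply: rA;
    exact: same_refl|exact: nbhs_singleton].
have [r xr rV] := Gx V nV.
have [s [xs sp _ srx]] := toward r (fun E => xr (esym E)).
by exists s; split=> //; apply: subset_trans rV; exact: sub.
Qed.

Lemma homeo_same (g : homeo X) c a b :
  same (homeo_fun g c) (homeo_fun g a) (homeo_fun g b) -> same c a b.
Proof.
have [_ [h [ch gK hK]]] := homeo_funP g.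
move=> [K [Ka Kc cK] Kb].
apply: (@same_connected X (h @` K)).
- by apply: connected_continuous_connected => //; exact: continuous_subspaceT.
- by exists (homeo_fun g a).
- by exists (homeo_fun g b).
- by move=> [y Ky yc]; apply: (Kc y Ky); rewrite /= -yc hK.
Qed.

(** * Collapsing maps in the Ellis semigroup *)

(** With [r] near [x], [s] near [e] and [t] of the order of [r] between [s] and [e], let [g] fix [x]
    and send [r] to [t]. Points off [U] are not on the side of [r] containing [x], so their images
    are not on the side of [t] containing [x], hence are on the side of [s] containing [e], inside
    [V]. *)
Lemma collapse x e U V : endpoint x -> endpoint e -> x <> e ->
  nbhs x U -> nbhs e V ->
  exists2 g : homeo X, homeo_fun g x = x &
    forall z, ~ U z -> V (homeo_fun g z).
Proof.
move=> ex ee xe nU nV; have [p Pp] := P0.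
have [r [xr rp rU]] := endpoint_small ex Pp nU.
(* Removing [x] from [V] keeps [x] off the side of [s] that contains [e], so that [x] and [s] lie on
   the same side of [t]. *)
have nV' : nbhs e (V `&` ~` [set x]).
  apply: filterI => //; apply: open_nbhs_nbhs; split; first exact: open_set1C.
  by move=> E; apply: xe.
have [s [es sp sV]] := endpoint_small ee Pp nV'.
have [t [tp ts te tse]] := edge_realized (fun E => es (esym E)) Pp.
have ste : same s t e by apply: Scross => // /same_sym.
have xt : x <> t by move=> E; have [_] := sV t (same_sym ste); apply; rewrite E.
have nsx : ~ same s e x by move=> /sV[_]; apply.
have tsx : same t s x.
  apply: contrapT => ntsx; apply: nsx; apply: same_trans (same_sym ste) _.
  exact: Scross ntsx.
have [|g [gx gr]] := homogeneous xr xt _ (etrans rp (esym (esym tp))).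
  by rewrite rp.
exists g => // z Uz.
have ntz : ~ same t x (homeo_fun g z).
  by rewrite -gr -{1}gx => /homeo_same/rU.
have [] // := sV (homeo_fun g z); apply: same_trans (same_sym ste) _.
by apply: Scross => // tsz; apply: ntz; apply: same_trans (same_sym tsx) tsz.
Qed.

(** The sets [H] generate a filter converging pointwise to [collapsed x e], and [collapse] provides
    a homeomorphism in each of them. *)
Lemma collapsed_ellis x e : endpoint x -> endpoint e -> x <> e ->
  closure (range (@homeo_fun X : homeo X -> {ptws X -> X})) (collapsed x e).
Proof.
move=> ex ee xe.
pose H (UV : set X * set X) := [set h : {ptws X -> X} | h x = x /\
  (exists g : homeo X, h = homeo_fun g) /\ forall z, ~ UV.1 z -> UV.2 (h z)].
pose F := filter_from [set UV | nbhs x UV.1 /\ nbhs e UV.2] H.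
have FF : Filter F.
  apply: filter_from_filter; first by exists (setT, setT); split;
    exact: filterT.
  move=> [U V] [U' V'] /= [nU nV] [nU' nV'].
  exists (U `&` U', V `&` V'); first by split; exact: filterI.
  move=> h [hx [hg hUV]]; split; split=> //; split=> // z Uz /=;
    by apply (hUV z) => -[].
have Fc : F --> collapsed x e.
  apply: pointwise_cvg => z W; rewrite /collapsed.
  have [->|zx] := eqVneq z x => nW.
    exists (setT, setT); first by split; exact: filterT.
    by move=> h [hx _] /=; rewrite hx; exact: nbhs_singleton.
  exists (~` [set z], W).
    split=> //=; apply: open_nbhs_nbhs; split; first exact: open_set1C.
    by move=> E; move: zx; rewrite E eqxx.
  by move=> h [_ [_ hW]]; apply: hW => /=; apply.
move=> B /Fc[[U V] [/= nU nV] HB].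
have [g gx gV] := collapse ex ee xe nU nV.
by exists (homeo_fun g); split; [exists g|apply: HB; split=> //; split=> //;
  exists g].
Qed.

(** Only the map with [x = z] can differ from [e] at [z], so the maps [collapsed x e] tend pointwise
    to the constant along the cofinite filter. *)
Lemma collapsed_cofinite e (B : set {ptws X -> X}) :
  nbhs (cst e : {ptws X -> X}) B -> finite_set [set x | ~ B (collapsed x e)].
Proof.
pose F : set_system {ptws X -> X} :=
  [set A | finite_set [set x | ~ A (collapsed x e)]].
have FF : Filter F.
  split.
  - by rewrite /F /= (_ : [set _ | _] = set0);
      [exact: finite_set0|apply/seteqP; split=> // z; apply].
  - move=> A A' fA fA'; apply:
      (@sub_finite_set _ _ ([set x | ~ A (collapsed x e)] `|` [set x | ~ A'
        (collapsed x e)])).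
      by move=> z /= /not_andP.
    by rewrite finite_setU.
  - by move=> A A' AA'; apply: sub_finite_set => z /=; apply: contra_not;
      exact: AA'.
have : F --> (cst e : {ptws X -> X}).
  apply: pointwise_cvg => z W nW.
  apply: (@sub_finite_set _ _ [set z]); last exact: finite_set1.
  move=> x /=; rewrite /collapsed; case: eqP => [//|_ We].
  by case: We; exact: nbhs_singleton nW.
by apply.
Qed.

Lemma cst_ellis e : endpoint e ->
  closure (range (@homeo_fun X : homeo X -> {ptws X -> X})) (cst e).
Proof.
move=> ee B; rewrite nbhsE => -[B' [oB' B'e] B'B].
have /collapsed_cofinite fB : nbhs (cst e : {ptws X ->
  X}) B' by exact: open_nbhs_nbhs.
have [|x ex nx] := endpoint_notin
    (C := [set x | ~ B' (collapsed x e)] `|` [set e]).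
  by apply: finite_set_countable; rewrite finite_setU; split=> //;
    exact: finite_set1.
have xe : x <> e by move=> E; apply: nx; right.
have Bx : B' (collapsed x e) by apply: contrapT => nB; apply: nx; left.
have [h [hr B'h]] := collapsed_ellis ex ee xe (open_nbhs_nbhs (conj oB' Bx)).
by exists h; split=> //; exact: B'B.
Qed.

End wazewski.

(** * Failure of first countability *)

Theorem theorem2p6 (R : realType) (P : set (option nat))
    (P_orders : P `<=` ramification_orders) (P_nonempty : P !=set0)
    (W : topologicalType) (W_P : wazewski_dendrite R P W) :
  ~ tame1 R (homeo_system (wazewski_compact W_P) (wazewski_metrizable W_P)).
Proof.
move=> [fcE _]; move: fcE; set E := ellis_semigroup _ => fcE.
have [e ee _] := endpoint_notin P_orders P_nonempty W_P (countable0 W).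
have [B nB Bbase] := fcE (SigSub (mem_set (cst_ellis P_orders P_nonempty W_P
  ee))).
(* These are the endpoints whose collapsed map is outside [B n]; as [B n] lives on a subtype, the
   condition ranges over proofs of membership in [E]. *)
pose bad n : set W := [set x | [/\ endpoint x, x <> e &
  forall hx : E (collapsed x e), ~ B n (SigSub (mem_set hx))]].
have finite_bad n : finite_set (bad n).
  have [_ [[/= V oV <-] Ve VB]] := nB n.
  apply: sub_finite_set (collapsed_cofinite (open_nbhs_nbhs (conj oV Ve))).
  move=> x [ex xe nBx] /= Vx.
  by apply: (nBx (collapsed_ellis P_orders P_nonempty W_P ex ee xe)); exact: VB.
(* The bad sets are finite, so some endpoint other than [e] lies outside all of them, and its map
   belongs to every [B n]. *)
have [|x ex nx] := endpoint_notin P_orders P_nonempty W_P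
  (C := (\bigcup_n bad n) `|` [set e]).
  rewrite -bigcup2inE; apply: bigcup_countable => // -[|[|[]]] //= _.
    by apply: bigcup_countable => // n _; exact: finite_set_countable.
have xe : x <> e by move=> xe; apply: nx; right.
have hx : E (collapsed x e) := collapsed_ellis P_orders P_nonempty W_P ex ee xe.
have hW : hausdorff_space W := metrizable_hausdorff (wazewski_metrizable W_P).
(* The condition that the value at [x] differs from [x] holds near the constant [e] but fails for
   [collapsed x e]. *)
have : nbhs (cst e x) (~` [set x]).
  by apply: open_nbhs_nbhs; split; [exact: open_set1C|move=> E'; apply: xe].
move=> /(@evaluation_nbhs W W (cst e) x); rewrite nbhsE => -[V [oV Ve] VU].
have [|n BV] := Bbase (set_val @^-1` V).
  by apply: open_nbhs_nbhs; split=> //; exists V.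
have Bx : B n (SigSub (mem_set hx)).
  apply: contrapT => nBx; apply: nx; left; exists n => //; split=> // hx'.
  by rewrite (_ : SigSub _ = SigSub (mem_set hx)) //; exact: val_inj.
have : (~` [set x]) (collapsed x e x) := VU _ (BV _ Bx).
by rewrite /collapsed eqxx; apply.
Qed.
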